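(* For every $n\ge1$, the finite rotation group $C_2^n$ acting on $\mathbb{R}^2$ has property $(\mathcal{B}_n)$, and the finite rotation group $C_3^n$ acting on $\mathbb{R}^3$ has property $(\mathcal{B}_n)$.
   Context: $C_2^n\subseteq O(2)$ is the cyclic group generated by the counterclockwise rotation of $\mathbb{R}^2$ through the angle $2\pi/n$. $C_3^n\subseteq O(3)$ is the cyclic group obtained by choosing a $2$-dimensional linear subspace $P\subset\mathbb{R}^3$ and extending each element of the group $C_2^n$ acting on $P$ to $\mathbb{R}^3$ by the identity on $P^\perp$. For an orthogonal representation $G\to O(V)$ of a finite group, let $\sigma_1,\ldots,\sigma_m$ be homogeneous generators of positive degree of the algebra $\mathbb{R}[V]^G$ of invariant polynomials and $\sigma=(\sigma_1,\ldots,\sigma_m):V\to\mathbb{R}^m$ the orbit map; $V/G$ is identified with $\sigma(V)\subseteq\mathbb{R}^m$ via the homeomorphism induced by $\sigma$. A curve in $V/G$ is of class $C^k$ if it is $C^k$ as a curve in $\mathbb{R}^m$ (independent of the choice of generators). A lift of a curve $c$ in $\sigma(V)$ is a curve $\bar c$ in $V$ with $\sigma\circ\bar c=c$; a local lift near $t_0$ is a lift of the restriction of $c$ to an open neighborhood of $t_0$. A differentiable lift has locally bounded derivative if $\|\bar c'\|$ is bounded on compact subsets of its domain. The representation has property $(\mathcal{B}_k)$ if there exists a neighborhood $U$ of $0$ in $V/G=\sigma(V)$ such that each $C^k$-curve in $U$ admits (near each parameter value) a local differentiable lift to $V$ with locally bounded derivative. *)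

(* Defs.v *)
From HB Require Import structures.
From mathcomp Require Import all_boot all_order all_algebra.
From mathcomp Require Import all_classical all_reals all_analysis.
From mathcomp Require mpoly.
From mathcomp Require Import ring.

Set Implicit Arguments.
Unset Strict Implicit.
Unset Printing Implicit Defensive.

Import Order.TTheory GRing.Theory Num.Theory.
Import numFieldNormedType.Exports.
(* The notations of mpoly clash with those of MathComp-Analysis. *)
Import (canonicals, coercions) mpoly.

Local Open Scope classical_set_scope.
Local Open Scope ring_scope.

(* A finite subgroup of O(d), acting on column vectors by left multiplication.
   The algebra of invariants, the orbit space and the lifts attached to an
   orthogonal representation of a finite group depend only on its image, which
   is such a subgroup. Closure under inverses follows from finiteness. *)
Record finOrthGroup (R : realType) (d : nat) := FinOrthGroup {
  og_set : set 'M[R]_d;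
  og_finite : finite_set og_set;
  og_orth : forall A, og_set A -> A^T *m A = 1%:M;
  og_one : og_set 1%:M;
  og_mul : forall A B, og_set A -> og_set B -> og_set (A *m B)
}.

Definition peval (R : realType) (d : nat) (v : 'cV[R]_d)
    (p : mpoly.mpoly d R) : R :=
  mpoly.meval (fun i => v i 0) p.

Definition invariant_poly (R : realType) (d : nat) (G : finOrthGroup R d)
    (p : mpoly.mpoly d R) : Prop :=
  forall A v, og_set G A -> peval (A *m v) p = peval v p.

(* [ishomog1 e mdeg] is the library's predicate "homogeneous of degree e", and
   [comp_mpoly s q] is q(s_1, ..., s_m). *)
Record hom_generators (R : realType) (d : nat) (G : finOrthGroup R d) (m : nat)
    (s : m.-tuple (mpoly.mpoly d R)) : Prop := HomGenerators {
  hg_homog : forall i, exists2 e : nat, (0 < e)%N &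
    tnth s i \is mpoly.ishomog1 e mpoly.mdeg;
  hg_inv : forall i, invariant_poly G (tnth s i);
  hg_gen : forall p, invariant_poly G p ->
    exists q : mpoly.mpoly m R, p = mpoly.comp_mpoly s q
}.

Definition orbit_map (R : realType) (d m : nat)
    (s : m.-tuple (mpoly.mpoly d R)) (v : 'cV[R]_d) : 'cV[R]_m :=
  \col_i peval v (tnth s i).

(* For I open, the values of the iterated derivatives of c on I depend only on
   the restriction of c to I. *)
Definition Ck_on (R : realType) (m k : nat) (I : set R) (c : R -> 'cV[R]_m) :
    Prop :=
  (forall j t, (j < k)%N -> I t -> derivable (derive1n j c) t 1) /\
  (forall t, I t -> {for t, continuous (derive1n k c)}).

(* The norm on 'cV[R]_d is the sup norm; since it is equivalent to the Euclidean
   one, boundedness of the derivative has the usual meaning. *)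
Definition diff_lift (R : realType) (d m : nat)
    (s : m.-tuple (mpoly.mpoly d R)) (J : set R) (c : R -> 'cV[R]_m)
    (cbar : R -> 'cV[R]_d) : Prop :=
  [/\ forall t, J t -> orbit_map s (cbar t) = c t,
      forall t, J t -> derivable cbar t 1 &
      forall K : set R, compact K -> K `<=` J -> [bounded derive1 cbar t | t in K]].

(* U ranges over the neighbourhoods of 0 in the subspace [range (orbit_map s)];
   curves are parametrized by open intervals I. A system s of generators exists
   by Hilbert's finiteness theorem; the property is independent of the choice
   of s, and is required for every s. *)
Definition property_B (R : realType) (d : nat) (G : finOrthGroup R d)
    (k : nat) : Prop :=
  forall (m : nat) (s : m.-tuple (mpoly.mpoly d R)), hom_generators G s ->
  exists U : set 'cV[R]_m,
  [/\ U `<=` range (orbit_map s),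
      within (range (orbit_map s)) (nbhs (0 : 'cV[R]_m)) U &
      forall (I : set R) (c : R -> 'cV[R]_m),
        open I -> is_interval I -> Ck_on k I c ->
        (forall t, I t -> U (c t)) ->
        forall t0, I t0 -> exists (J : set R) (cbar : R -> 'cV[R]_d),
          [/\ open J, J t0, J `<=` I & diff_lift s J c cbar]].

Definition rot2 (R : realType) (a : R) : 'M[R]_2 :=
  \matrix_(i < 2, j < 2)
    if i == j then cos a else if i == 0 then - sin a else sin a.

Definition C2_set (R : realType) (n : nat) : set 'M[R]_2 :=
  [set A | exists k : nat, A = rot2 (2 * pi / n%:R) ^+ k].

(* B is the matrix of a linear isometry of R^2 onto P, that is, its columns form
   an orthonormal basis of P. *)
Definition isometry_onto (R : realType) (P : {vspace 'cV[R]_3})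
    (B : 'M[R]_(3, 2)) : Prop :=
  B^T *m B = 1%:M /\ forall w, w \in P <-> exists x : 'cV[R]_2, w = B *m x.

(* The identification B of P with R^2 through which C_2^n acts on P is
   arbitrary: two of them differ by an element of O(2), which normalizes
   C_2^n. *)
Definition C3_set (R : realType) (n : nat) (P : {vspace 'cV[R]_3}) :
    set 'M[R]_3 :=
  [set A | exists B g, [/\ isometry_onto P B, C2_set n g,
     forall x : 'cV[R]_2, A *m (B *m x) = B *m (g *m x) &
     forall v : 'cV[R]_3, (forall w, w \in P -> w^T *m v = 0) -> A *m v = v]].

Section Groups.
Variable R : realType.

Lemma mx2P (A B : 'M[R]_2) : A 0 0 = B 0 0 -> A 0 1 = B 0 1 ->
  A 1 0 = B 1 0 -> A 1 1 = B 1 1 -> A = B.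
Proof.
move=> h1 h2 h3 h4; apply/matrixP=> i j.
have E (k : 'I_2) : k = 0 \/ k = 1.
  by case: k => [[|[|k]]] // hk; [left|right]; apply/val_inj.
by case: (E i) => ->; case: (E j) => ->.
Qed.

Lemma mulmx2E (p q : nat) (A : 'M[R]_(p, 2)) (B : 'M[R]_(2, q)) i j :
  (A *m B) i j = A i 0 * B 0 j + A i 1 * B 1 j.
Proof.
rewrite mxE !big_ord_recl big_ord0 addr0.
by congr (A i _ * B _ j + A i _ * B _ j); apply/val_inj.
Qed.

Lemma rot2D (a b : R) : rot2 a *m rot2 b = rot2 (a + b).
Proof. by apply/mx2P; rewrite mulmx2E !mxE /= ?cosD ?sinD; ring. Qed.

Lemma rot2_0 : rot2 (0 : R) = 1%:M.
Proof. by apply/mx2P; rewrite !mxE /= ?cos0 ?sin0 ?oppr0. Qed.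

Lemma rot2X (a : R) k : rot2 a ^+ k = rot2 (a *+ k).
Proof.
elim: k => [|k IH]; first by rewrite expr0 mulr0n rot2_0.
by rewrite exprS IH mulrS -rot2D.
Qed.

Lemma rot2T (a : R) : (rot2 a)^T = rot2 (- a).
Proof. by apply/mx2P; rewrite !mxE /= ?cosN ?sinN ?opprK. Qed.

Lemma rot2_orth (a : R) : (rot2 a)^T *m rot2 a = 1%:M.
Proof. by rewrite rot2T rot2D addNr rot2_0. Qed.

Lemma rot2_2pi : rot2 (2 * pi : R) = 1%:M.
Proof.
by rewrite mulr_natl; apply/mx2P; rewrite !mxE /= ?cos2pi ?sin2pi ?oppr0.
Qed.

Lemma rot2_order n : rot2 (2 * pi / n%:R : R) ^+ n = 1.
Proof.
case: n => [|n]; first by rewrite expr0.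
by rewrite rot2X -[_ *+ n.+1]mulr_natr divfK ?pnatr_eq0// rot2_2pi.
Qed.

Lemma C2_setP n (A : 'M[R]_2) : C2_set n A ->
  exists2 k, (k < n.+1)%N & A = rot2 (2 * pi / n%:R : R) ^+ k.
Proof.
case=> k ->; case: n => [|n].
  by exists 0%N => //; rewrite invr0 mulr0 rot2_0 !expr1n.
exists (k %% n.+1)%N; first by rewrite ltnS ltnW// ltn_pmod.
by rewrite {1}(divn_eq k n.+1) exprD mulnC exprM rot2_order expr1n mul1r.
Qed.

Lemma C2_finite n : finite_set (C2_set n : set 'M[R]_2).
Proof.
apply: (@sub_finite_set _ _
  ((fun k => rot2 (2 * pi / n%:R : R) ^+ k) @` `I_n.+1)); last first.
  by apply: finite_image; apply: finite_II.
by move=> A /C2_setP[k kn ->]; exists k.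
Qed.

Lemma C2_orth n (A : 'M[R]_2) : C2_set n A -> A^T *m A = 1%:M.
Proof. by case=> k ->; rewrite rot2X rot2_orth. Qed.

Lemma C2_one n : C2_set n (1%:M : 'M[R]_2).
Proof. by exists 0%N. Qed.

Lemma C2_mul n (A B : 'M[R]_2) :
  C2_set n A -> C2_set n B -> C2_set n (A *m B).
Proof. by case=> k -> [l ->]; exists (k + l)%N; rewrite exprD. Qed.

Lemma C2_tr n (A : 'M[R]_2) : C2_set n A -> C2_set n A^T.
Proof.
move=> nA; have [k kn AE] := C2_setP nA.
have : C2_set n (rot2 (2 * pi / n%:R : R) ^+ (n - k)) by exists (n - k)%N.
suff -> : rot2 (2 * pi / n%:R : R) ^+ (n - k) = A^T by [].
set X := rot2 _ ^+ (n - k).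
have XA : X *m A = 1%:M.
  by rewrite AE mulmxE /X -exprD subnK// rot2_order.
by rewrite -[LHS]mulmx1 -(mulmx1C (C2_orth nA)) mulmxA XA mul1mx.
Qed.

Definition C2 (n : nat) : finOrthGroup R 2 :=
  FinOrthGroup (@C2_finite n) (@C2_orth n) (@C2_one n) (@C2_mul n).

Lemma C2_conj n (Q A : 'M[R]_2) : Q^T *m Q = 1%:M -> C2_set n A ->
  C2_set n (Q *m A *m Q^T).
Proof.
move=> QQ nA; have QQ' := mulmx1C QQ.
suff [->|->] : Q *m A *m Q^T = A \/ Q *m A *m Q^T = A^T.
- by [].
- exact: C2_tr.
case: nA => k ->; rewrite rot2X rot2T; set a := _ *+ k.
have h00 := congr1 (fun M : 'M[R]_2 => M 0 0) QQ'.
have h01 := congr1 (fun M : 'M[R]_2 => M 0 1) QQ'.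
have h11 := congr1 (fun M : 'M[R]_2 => M 1 1) QQ'.
rewrite !mulmx2E !mxE /= in h00 h01 h11.
set p := Q 0 0 in h00 h01 h11 *; set q := Q 0 1 in h00 h01 h11 *.
set r := Q 1 0 in h00 h01 h11 *; set t := Q 1 1 in h00 h01 h11 *.
have dd : (p * t - q * r - 1) * (p * t - q * r + 1) = 0.
  have -> : (p * t - q * r - 1) * (p * t - q * r + 1) =
    (p * p + q * q) * (r * r + t * t) - (p * r + q * t) ^+ 2 - 1 by ring.
  by rewrite h00 h01 h11; ring.
move/eqP: dd; rewrite mulf_eq0 subr_eq0 addr_eq0 => /orP[] /eqP dt.
- left; apply/mx2P; rewrite !mulmx2E !mxE /= -/p -/q -/r -/t.
  + have -> : (p * cos a + q * sin a) * p + (p * - sin a + q * cos a) * q =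
      cos a * (p * p + q * q) by ring.
    by rewrite h00 mulr1.
  + have -> : (p * cos a + q * sin a) * r + (p * - sin a + q * cos a) * t =
      cos a * (p * r + q * t) - sin a * (p * t - q * r) by ring.
    by rewrite h01 dt; ring.
  + have -> : (r * cos a + t * sin a) * p + (r * - sin a + t * cos a) * q =
      cos a * (p * r + q * t) + sin a * (p * t - q * r) by ring.
    by rewrite h01 dt; ring.
  + have -> : (r * cos a + t * sin a) * r + (r * - sin a + t * cos a) * t =
      cos a * (r * r + t * t) by ring.
    by rewrite h11 mulr1.
- right; apply/mx2P; rewrite !mulmx2E !mxE /= -/p -/q -/r -/t ?cosN ?sinN.
  + have -> : (p * cos a + q * sin a) * p + (p * - sin a + q * cos a) * q =
      cos a * (p * p + q * q) by ring.
    by rewrite h00 mulr1.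
  + have -> : (p * cos a + q * sin a) * r + (p * - sin a + q * cos a) * t =
      cos a * (p * r + q * t) - sin a * (p * t - q * r) by ring.
    by rewrite h01 dt; ring.
  + have -> : (r * cos a + t * sin a) * p + (r * - sin a + t * cos a) * q =
      cos a * (p * r + q * t) + sin a * (p * t - q * r) by ring.
    by rewrite h01 dt; ring.
  + have -> : (r * cos a + t * sin a) * r + (r * - sin a + t * cos a) * t =
      cos a * (r * r + t * t) by ring.
    by rewrite h11 mulr1.
Qed.

Lemma isometry_exists (P : {vspace 'cV[R]_3}) : \dim P = 2%N ->
  exists B, isometry_onto P B.
Proof.
move=> dimP.
pose dot (x y : 'cV[R]_3) : R := (x^T *m y) 0 0.
have dotE x y : x^T *m y = (dot x y)%:M by rewrite [LHS]mx11_scalar.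
have dotC x y : dot x y = dot y x.
  have -> : dot y x = (x^T *m y)^T 0 0 by rewrite trmx_mul trmxK.
  by rewrite mxE.
have dotDr x y z : dot x (y + z) = dot x y + dot x z.
  by rewrite /dot mulmxDr mxE.
have dotZr x c y : dot x (c *: y) = c * dot x y.
  by rewrite /dot -scalemxAr mxE.
have dot_ge0 x : 0 <= dot x x.
  by rewrite /dot mxE sumr_ge0// => i _; rewrite mxE -expr2 sqr_ge0.
have dot_eq0 x : dot x x = 0 -> x = 0.
  move=> x0; apply/matrixP => i j; rewrite ord1 mxE; move: x0.
  rewrite /dot mxE => /eqP; rewrite psumr_eq0; last first.
    by move=> k _; rewrite mxE -expr2 sqr_ge0.
  move=> /allP /(_ i); rewrite mem_index_enum => /(_ isT) /=.
  by rewrite mxE mulf_eq0 orbb => /eqP.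
have normalize x : x != 0 -> exists2 c : R, c != 0 & dot (c *: x) (c *: x) = 1.
  move=> x0; have dx : 0 < dot x x.
    by rewrite lt0r dot_ge0 andbT; apply: contra_neq x0; exact: dot_eq0.
  exists (Num.sqrt (dot x x))^-1; first by rewrite invr_eq0 gt_eqF// sqrtr_gt0.
  rewrite dotZr dotC dotZr mulrA -expr2 exprVn sqr_sqrtr//.
  by rewrite mulVf// gt_eqF.
have Pb := vbasisP P.
have [u [v [uv Puv]]] : exists u v : 'cV[R]_3,
    free [:: u; v] /\ <<[:: u; v]>>%VS = P.
  have := size_tuple (vbasis P); move: (basis_free Pb) (span_basis Pb).
  move: (tval (vbasis P)); rewrite dimP => -[|u [|v [|? ?]]] //= ? ? _.
  by exists u, v.
have u0 : u != 0.
  by apply: contraTneq uv => ->; rewrite free_cons mem0v.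
have [c c0 cu] := normalize u u0.
have [e eE] : exists e, e = c *: u by exists (c *: u).
rewrite -eE in cu.
have [w w0 [[a wE] ew]] : exists2 w, w != 0 &
    (exists a, w = v + a *: e) /\ dot e w = 0.
  exists (v + (- dot e v) *: e); last first.
    by split; [eexists; reflexivity | rewrite dotDr dotZr cu mulr1 subrr].
  apply: contraTneq uv; rewrite scaleNr => /subr0_eq vE.
  have uvE : perm_eq [:: u; v] [:: v; u] by rewrite (perm_catC [:: u] [:: v]).
  rewrite (perm_free uvE) free_cons span_seq1 vE eE scalerA.
  by rewrite memvZ ?memv_line.
have [b b0 bw] := normalize w w0.
have [f fE] : exists f, f = b *: w by exists (b *: w).
rewrite -fE in bw.
have ef : dot e f = 0 by rewrite fE dotZr ew mulr0.
pose B : 'M[R]_(3, 1 + 1) := row_mx e f.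
exists B; split.
  suff : B^T *m B = (1%:M : 'M[R]_(1 + 1)) by [].
  rewrite /B tr_row_mx mul_col_row !dotE cu bw ef dotC ef.
  by rewrite (raddf0 (@scalar_mx R 1)) (@scalar_mx_block R 1 1).
have BE (x : 'cV[R]_(1 + 1)) : B *m x = usubmx x 0 0 *: e + dsubmx x 0 0 *: f.
  rewrite -{1}[x]vsubmxK /B mul_row_col.
  by rewrite [usubmx x]mx11_scalar [dsubmx x]mx11_scalar !mul_mx_scalar !mxE.
have eP : e \in P.
  by rewrite eE -Puv memvZ// memv_span// mem_head.
have vP : v \in P by rewrite -Puv memv_span// !inE eqxx orbT.
have wP : w \in P by rewrite wE memvD// memvZ.
have fP : f \in P by rewrite fE memvZ.
move=> z; split=> [|[x ->]]; last by rewrite BE memvD// memvZ.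
rewrite -Puv span_cons span_seq1 => /memv_addP[_ /vlineP[k ->]].
move=> [_ /vlineP[l ->] ->].
have uE : u = c^-1 *: e by rewrite eE scalerA mulVf// scale1r.
have vE : v = b^-1 *: f - a *: e by rewrite fE scalerA mulVf// scale1r wE addrK.
exists (col_mx (k / c - l * a)%:M (l / b)%:M : 'cV[R]_(1 + 1)).
rewrite BE col_mxKu col_mxKd !mxE /= !mulr1n {1}uE vE.
by rewrite scalerBr !scalerA scalerBl addrA addrAC.
Qed.

Lemma isometry_change (P : {vspace 'cV[R]_3}) B B' :
  isometry_onto P B -> isometry_onto P B' ->
  exists2 Q : 'M[R]_2, Q^T *m Q = 1%:M & B' = B *m Q.
Proof.
move=> [BB BP] [BB' BP']; exists (B^T *m B'); last first.
  apply/matrixP => i j.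
  have : col j B' \in P.
    by apply/BP'; exists (delta_mx j 0); rewrite colE.
  move=> /BP[x xE]; transitivity (col j (B *m (B^T *m B')) i 0).
    by rewrite colE -!mulmxA -colE xE (mulmxA B^T) BB mul1mx -xE mxE.
  by rewrite mxE.
rewrite trmx_mul trmxK -mulmxA (mulmxA B).
suff -> : B *m B^T *m B' = B' by [].
apply/matrixP => i j.
have : col j B' \in P.
  by apply/BP'; exists (delta_mx j 0); rewrite colE.
move=> /BP[x xE]; transitivity (col j (B *m B^T *m B') i 0).
  by rewrite [RHS]mxE.
by rewrite colE -!mulmxA -colE xE (mulmxA B^T) BB mul1mx -xE mxE.
Qed.

Lemma ext_mul (B : 'M[R]_(3, 2)) (g h : 'M[R]_2) : B^T *m B = 1%:M ->
  (B *m g *m B^T + (1%:M - B *m B^T)) *m (B *m h *m B^T + (1%:M - B *m B^T)) =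
  B *m (g *m h) *m B^T + (1%:M - B *m B^T).
Proof.
move=> BB; set N := 1%:M - B *m B^T.
have NB : N *m B = 0 by rewrite mulmxBl mul1mx -mulmxA BB mulmx1 subrr.
have BN : B^T *m N = 0 by rewrite mulmxBr mulmx1 mulmxA BB mul1mx subrr.
have NN : N *m N = N by rewrite {1}/N mulmxBl mul1mx -mulmxA BN mulmx0 subr0.
rewrite [LHS]mulmxDl [X in X + _]mulmxDr [X in _ + X]mulmxDr NN -(mulmxA (B *m g) B^T N) BN mulmx0 addr0.
rewrite -(mulmxA B h) (mulmxA N) NB mul0mx add0r.
by rewrite -!mulmxA (mulmxA B^T B) BB mul1mx.
Qed.

Section C3.
Variables (n : nat) (P : {vspace 'cV[R]_3}).

Lemma C3_setE B A : isometry_onto P B ->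
  C3_set n P A <->
  exists2 g, C2_set n g & A = B *m g *m B^T + (1%:M - B *m B^T).
Proof.
move=> isoB; have [BB BP] := isoB; split; last first.
  move=> [g ng ->]; exists B, g; split=> //.
    move=> x; rewrite mulmxDl mulmxBl mul1mx -!mulmxA (mulmxA B^T B) BB.
    by rewrite mul1mx subrr addr0.
  move=> v vP; have BTv : B^T *m v = 0.
    apply/matrixP => i j; rewrite ord1 [RHS]mxE.
    have /vP : col i B \in P by apply/BP; exists (delta_mx i 0); rewrite colE.
    by move=> /(congr1 (fun M : 'M[R]_1 => M 0 0)); rewrite tr_col -row_mul !mxE.
  by rewrite mulmxDl mulmxBl mul1mx -!mulmxA BTv !mulmx0 subr0 add0r.
move=> [B' [g [isoB' ng AB' Aperp]]].
have [Q QQ B'E] := isometry_change isoB isoB'.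
have AQ : A *m B = B *m (Q *m g *m Q^T).
  have AB : A *m B' = B' *m g.
    apply/matrixP => i j; have := congr1 (fun M : 'cV[R]_3 => M i 0)
      (AB' (delta_mx j 0)).
    by rewrite !mulmxA -!colE !mxE.
  transitivity (A *m (B *m Q) *m Q^T); last by rewrite -B'E AB B'E !mulmxA.
  by rewrite -!mulmxA (mulmx1C QQ) mulmx1.
exists (Q *m g *m Q^T); first exact: C2_conj.
have AN : A *m (1%:M - B *m B^T) = 1%:M - B *m B^T.
  apply/matrixP => i j; set N := (1%:M - B *m B^T).
  have /(congr1 (fun M : 'cV[R]_3 => M i 0)) : A *m col j N = col j N.
    apply: Aperp => w /BP[x ->]; rewrite colE trmx_mul mulmxA -(mulmxA x^T).
    by rewrite /N mulmxBr mulmx1 mulmxA BB mul1mx subrr mulmx0 mul0mx.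
  by rewrite colE mulmxA -!colE !mxE.
by rewrite -AQ -[in RHS]AN mulmxBr mulmx1 mulmxA addrC subrK.
Qed.

Hypothesis dimP : \dim P = 2%N.

Lemma C3_finite : finite_set (C3_set n P).
Proof.
have [B BP] := isometry_exists dimP.
apply: (@sub_finite_set _ _
  ((fun g => B *m g *m B^T + (1%:M - B *m B^T)) @` C2_set n)).
  by move=> A /(C3_setE _ BP)[g ng ->]; exists g.
by apply: finite_image; exact: C2_finite.
Qed.

Lemma C3_one : C3_set n P 1%:M.
Proof.
have [B BP] := isometry_exists dimP.
apply/(C3_setE _ BP); exists 1%:M; first exact: C2_one.
by rewrite mulmx1 addrC subrK.
Qed.

Lemma C3_mul A A' : C3_set n P A -> C3_set n P A' -> C3_set n P (A *m A').
Proof.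
have [B BP] := isometry_exists dimP.
have BB : B^T *m B = 1%:M by case: BP.
move=> /(C3_setE _ BP)[g ng ->] /(C3_setE _ BP)[h nh ->].
apply/(C3_setE _ BP); exists (g *m h); first exact: C2_mul.
exact: ext_mul.
Qed.

Lemma C3_orth A : C3_set n P A -> A^T *m A = 1%:M.
Proof.
have [B BP] := isometry_exists dimP.
have BB : B^T *m B = 1%:M by case: BP.
move=> /(C3_setE _ BP)[g ng ->].
have -> : (B *m g *m B^T + (1%:M - B *m B^T))^T =
    B *m g^T *m B^T + (1%:M - B *m B^T).
  by rewrite [LHS]raddfD [X in _ + X]raddfB /= !trmx_mul trmxK trmx1 mulmxA.
by rewrite ext_mul// (C2_orth ng) mulmx1 addrC subrK.
Qed.

Definition C3 : finOrthGroup R 3 :=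
  FinOrthGroup C3_finite C3_orth C3_one C3_mul.

End C3.
End Groups.

(* Main.v *)
Require Import Defs.
From mathcomp Require Import all_boot all_order all_algebra.
From mathcomp Require Import all_classical all_reals all_analysis.
From mathcomp Require Import complex.
From mathcomp Require mpoly.
From mathcomp Require Import ring lra.

(** Identify the rotation plane with the complex numbers. Apart from the
coordinates orthogonal to the plane, on which the group acts trivially and
which are linear invariants, the orbit of a point with plane component [z] is
determined by [f = z ^+ n], and [r = |z|^2] is a further invariant with
[|f|^2 = r ^+ n]. Every invariant polynomial is a polynomial in the given
generators, so along a [C^n] curve in the orbit space [r], [f] and the
orthogonal coordinates are [C^n] functions of the parameter, and a lift amounts
to a differentiable [n]-th root of [f] with locally bounded derivative
([extended_rotation_property_B]); two points of the plane with the same [n]-th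
power differ by an element of the group ([root_rot2]).

For [n = 1] the root is [f] itself. Let [n >= 2].

Bound on the derivative. Where [r t > 0], a differentiable root [w] satisfies
[n |w|^(n-1) |w'| = |f'|], so one needs [|f'| <= C r^((n-1)/2)] ([root_bound]).
Since [r] is nonnegative and of class [C^2], it grows by at most a constant
factor on an interval of length comparable to [sqrt (r t)]; there [|f|] is at
most a constant times [r^(n/2)], and the estimate follows from Landau's
interpolation inequality between [f] and its [n]-th derivative
([interpolation]).

Zeros of [r]. At a zero [t] one has [r (t + h) = O(h^2)], hence [f (t + h) =
O(h^n)], and then [r (t + h) / h^2] and [f (t + h) / h^n] have limits as [h]
tends to [0] ([power_quotient_cvg]). If the first limit vanishes, every root
is [o(h)] at [t], hence differentiable there. If not, the zero is isolated and
[h] times an [n]-th root of [f (t + h) / h^n] is a differentiable root near [t]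
([root_lift_local]).

Gluing. On the open set of parameters which are not zeros of the first kind,
differentiable roots exist locally, two of them differ near each point by a
constant root of unity, and they agree near a point as soon as they agree near
points accumulating at it. Because the parameters
lie on the line, where no loops occur, this yields a root on the whole open set
([monodromy]); extended by [0] it is the required root
([root_curve_order_ge2]). *)

Set Implicit Arguments.
Unset Strict Implicit.
Unset Printing Implicit Defensive.

Import Order.TTheory GRing.Theory Num.Theory.
Import numFieldNormedType.Exports.
Import (canonicals, coercions) mpoly.

Local Open Scope ring_scope.
Local Open Scope classical_set_scope.

Local Notation re := (@complex.Re _).
Local Notation im := (@complex.Im _).

(** * Mean value inequalities and interpolation *)

(** The values are typed in the ring [R], not in [R] as a normed module over itself,
so that ring identities apply to them. *)
Definition der (R : realType) (f : R -> R) : R -> R := derive1 f.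
Arguments der {R} f.

Lemma derP (R : realType) (f : R -> R) (t : R) :
  derivable f t 1 -> is_derive t 1 f (der f t).
Proof. by rewrite /der derive1E => /derivableP. Qed.

Section MeanValue.
Variable R : realType.
Implicit Types (f : R -> R) (a b x t M A B d : R).

Lemma mean_value_le f a b M : a <= b ->
  (forall t, a <= t <= b -> derivable f t 1) ->
  (forall t, a < t < b -> `|der f t| <= M) -> `|f b - f a| <= M * (b - a).
Proof.
rewrite le_eqVlt => /predU1P[->|ab] df fM; first by rewrite !subrr normr0 mulr0.
have [t tab ->] : exists2 t, t \in `]a, b[%R & f b - f a = der f t * (b - a).
  apply: MVT => //.
  - move=> t /itvP tab; apply: derP; apply: df.
    by rewrite !tab.
  - apply: derivable_within_continuous => t; rewrite in_itv/=; exact: df.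
rewrite in_itv/= in tab.
by rewrite normrM (@gtr0_norm _ (b - a)) ?subr_gt0// ler_wpM2r ?fM// subr_ge0 ltW.
Qed.

Lemma mean_value_dist f a b M :
  (forall t, Num.min a b <= t <= Num.max a b -> derivable f t 1) ->
  (forall t, Num.min a b < t < Num.max a b -> `|der f t| <= M) ->
  `|f b - f a| <= M * `|b - a|.
Proof.
case: (leP a b) => ab df fM.
  by rewrite (@ger0_norm _ (b - a)) ?subr_ge0//; exact: mean_value_le.
rewrite distrC (distrC b) (@gtr0_norm _ (a - b)) ?subr_gt0//.
by apply: mean_value_le => //; exact: ltW.
Qed.

(** Apply the mean value inequality to [f] minus its tangent at [a], whose
derivative is itself bounded by the mean value inequality for [f']. *)
Lemma first_order_dist f a b M : 0 <= M ->
  (forall t, Num.min a b <= t <= Num.max a b -> derivable f t 1) ->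
  (forall t, Num.min a b <= t <= Num.max a b -> derivable (der f) t 1) ->
  (forall t, Num.min a b <= t <= Num.max a b -> `|(der (der f)) t| <= M) ->
  `|f b - f a - der f a * (b - a)| <= M * `|b - a| ^+ 2.
Proof.
move=> M0 df ddf fM.
pose g := fun t => f t - der f a * t.
have dg t : derivable f t 1 -> is_derive t 1 g (der f t - der f a).
  move=> /derP dft; rewrite /g.
  by apply: is_derive_eq; rewrite [_%:A]mulr1.
have -> : f b - f a - der f a * (b - a) = g b - g a by rewrite /g; ring.
rewrite expr2 mulrA; apply: mean_value_dist => t tab.
  by have [] := dg _ (df _ tab).
have tab' : Num.min a b <= t <= Num.max a b by case/andP: tab => *; rewrite !ltW.
rewrite /der derive1E; have [_ ->] := dg _ (df _ tab').
have ab0 : Num.min a b <= a /\ a <= Num.max a b by case: (leP a b) => [|/ltW].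
have dta : `|t - a| <= `|b - a|.
  move: tab'; case: (leP a b) => ab /andP[h1 h2].
    by rewrite !ger0_norm ?subr_ge0//; lra.
  by rewrite !ler0_norm ?subr_le0// ?(ltW ab)//; lra.
apply: (le_trans _ (ler_wpM2l M0 dta)).
have sub s : Num.min a t <= s <= Num.max a t -> Num.min a b <= s <= Num.max a b.
  case: ab0 => ? ?; case/andP: tab' => ? ? /andP[s1 s2].
  rewrite (le_trans _ s1) ?le_min; last by apply/andP.
  by rewrite (le_trans s2)// ge_max; apply/andP.
apply: mean_value_dist => s sat; first exact/ddf/sub.
by apply/fM/sub; case/andP: sat => *; rewrite !ltW.
Qed.

(** Landau's inequality. Induction on the order: at a point [m] where [|f'|] is
maximal, a step of length [e * d] inside the interval bounds [|f' m|] by a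
difference quotient of [f] plus [e * d] times the bound on [f''] provided by
the induction hypothesis for [f']. That bound contains [|f' m|] itself, and it
is absorbed by the left side when [e] is small. *)
Lemma interpolation k : exists2 C : R, 0 <= C & forall f x d A B,
  0 < d -> 0 <= A -> 0 <= B ->
  (forall j t, (j < k.+1)%N -> x <= t <= x + d -> derivable (iter j der f) t 1) ->
  (forall t, x <= t <= x + d -> `|f t| <= A) ->
  (forall t, x <= t <= x + d -> `|iter k.+1 der f t| <= B) ->
  forall t, x <= t <= x + d -> `|der f t| <= C * (A / d + B * d ^+ k).
Proof.
elim: k => [|k [C C0 IH]].
  exists 1 => // f x d A B d0 A0 B0 _ _ fB t xt.
  by rewrite mul1r expr0 mulr1 (le_trans (fB t xt))// lerDr divr_ge0// ltW.
(* With this e, one has e * C <= 1/2 and the step e * d fits on one side of m. *)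
pose e := (2 * (1 + C))^-1; have C1 : 0 < 1 + C by rewrite ltr_wpDr.
have e0 : 0 < e by rewrite invr_gt0 mulr_gt0.
have eC : e * C <= 2^-1.
  by rewrite /e invfM -mulrA ler_piMr ?invr_ge0// mulrC ler_pdivrMr// mul1r lerDr.
have e2 : e <= 2^-1 by rewrite /e invfM ler_piMr ?invr_ge0// invf_le1// lerDl.
exists (4 / e + 1); first by rewrite addr_ge0// divr_ge0// ltW.
move=> f x d A B d0 A0 B0 df fA fB t xt.
have df0 s : x <= s <= x + d -> derivable f s 1 by move=> /(df 0%N); apply.
have df1 s : x <= s <= x + d -> derivable (der f) s 1 by move=> /(df 1%N); apply.
have [m xm mP] : exists2 m, x <= m <= x + d &
    forall s, x <= s <= x + d -> `|der f s| <= `|der f m|.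
  have [||m xm mP] := @EVT_max R (fun s => `|der f s|) x (x + d).
  - by rewrite lerDl ltW.
  - have cf : {within `[x, x + d], continuous (der f)}.
      by apply: derivable_within_continuous => s; rewrite in_itv/=; exact: df1.
    move=> s; apply: continuous_comp; first exact: cf.
    exact: norm_continuous.
  - rewrite in_itv/= in xm; exists m => // s xs; apply: mP; by rewrite in_itv.
apply: le_trans (mP t xt) _.
set S := `|der f m|; have S0 : 0 <= S by rewrite normr_ge0.
pose T := C * (S / d + B * d ^+ k).
have T0 : 0 <= T by rewrite mulr_ge0// addr_ge0// ?divr_ge0 ?mulr_ge0 ?exprn_ge0// ltW.
have f2 s : x <= s <= x + d -> `|(der (der f)) s| <= T.
  apply: IH => // [j u jk xu|u xu].
  - by rewrite -iterSr; apply: df.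
  - by rewrite -iterSr; apply: fB.
pose h := e * d; have h0 : 0 < h by rewrite mulr_gt0.
have hd : h <= d / 2 by rewrite /h mulrC ler_wpM2l// ltW.
have [q [xq qm]] : exists q, x <= q <= x + d /\ `|q - m| = h.
  case/andP: xm => xm mx; have [mle|mge] := leP m (x + d / 2).
  - exists (m + h); split; last by rewrite addrAC subrr add0r gtr0_norm.
    apply/andP; split; lra.
  - exists (m - h); split; last by rewrite addrAC subrr add0r normrN gtr0_norm.
    apply/andP; split; lra.
have sub s : Num.min m q <= s <= Num.max m q -> x <= s <= x + d.
  case/andP: xm => ? ?; case/andP: xq => ? ? /andP[s1 s2].
  rewrite (le_trans _ s1) ?le_min; last by apply/andP.
  by rewrite (le_trans s2)// ge_max; apply/andP.
have := @first_order_dist f m q T T0 (fun s hs => df0 s (sub s hs))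
  (fun s hs => df1 s (sub s hs)) (fun s hs => f2 s (sub s hs)).
rewrite qm => hT.
have Sh : S * h <= 2 * A + T * h ^+ 2.
  rewrite /S -qm -normrM qm.
  have -> : der f m * (q - m) = f q - f m - (f q - f m - der f m * (q - m)) by ring.
  apply: le_trans (ler_normB _ _) _; apply: lerD => //.
  apply: le_trans (ler_normB _ _) _; rewrite mulr_natl mulr2n.
  by apply: lerD; exact: fA.
have {}Sh : S <= 2 * A / h + T * h.
  rewrite -(ler_pM2r h0) mulrDl divfK ?gt_eqF//.
  by rewrite -mulrA -expr2.
have Th : T * h <= S / 2 + B * d ^+ k.+1 / 2.
  have -> : T * h = e * C * (S + B * d ^+ k.+1).
    by rewrite /T /h exprS; field; rewrite gt_eqF.
  rewrite -mulrDl mulrC ler_wpM2l// addr_ge0// mulr_ge0// exprn_ge0// ltW//.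
have Ah : 2 * A / h = 2 / e * (A / d) by rewrite /h; field; rewrite !gt_eqF.
set u := A / d in Ah *; set v := B * d ^+ k.+1 in Th *.
have u0 : 0 <= u by rewrite divr_ge0// ltW.
have v0 : 0 <= v by rewrite mulr_ge0// exprn_ge0// ltW.
have w0 : 0 <= e^-1 by rewrite invr_ge0 ltW.
rewrite Ah in Sh; set w := e^-1 in w0 Sh *.
have wv : 0 <= w * v by rewrite mulr_ge0.
have wu : 0 <= w * u by rewrite mulr_ge0.
nra.
Qed.

End MeanValue.

(** * Functions of class C^k *)

Section Smooth.
Variable R : realType.
Implicit Types (f g : R -> R) (I J : set R) (t y h : R).

Lemma nearP y (P : R -> Prop) : (\forall t \near y, P t) <->
  exists2 e : R, 0 < e & forall t, `|t - y| < e -> P t.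
Proof.
split=> [/nbhs_ballP[e e0 eP]|[e e0 eP]].
  by exists e => // t ty; apply: eP; rewrite /ball/= distrC.
by apply/nbhs_ballP; exists e => // t; rewrite /ball/= distrC => /eP.
Qed.

Lemma dnearP (P : R -> Prop) : (\forall h \near 0^', P h) <->
  exists2 e : R, 0 < e & forall h, h != 0 -> `|h| < e -> P h.
Proof.
rewrite near_withinE; split.
  by move=> /nearP[e e0 eP]; exists e => // h h0 he; apply: eP; rewrite ?subr0.
by move=> [e e0 eP]; apply/nearP; exists e => // h; rewrite subr0 => he h0; exact: eP.
Qed.

Lemma dnbhs0_near y (P : R -> Prop) :
  (\forall h \near 0^', P (y + h)) -> P y -> \forall t \near y, P t.
Proof.
move=> /dnearP[e e0 eP] Py; apply/nearP; exists e => // t te.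
have [->//|ty] := eqVneq t y.
by have := eP (t - y); rewrite subr_eq0 ty [y + _]addrC subrK; apply.
Qed.

Lemma near_dnbhs0 y (P : R -> Prop) :
  (\forall t \near y, P t) -> \forall h \near 0^', P (y + h).
Proof.
move=> /nearP[e e0 eP]; apply/dnearP; exists e => // h _ he.
by apply: eP; rewrite addrC addKr.
Qed.

(** The recursion on derivatives makes closure properties provable by induction on
[k]. *)
Fixpoint Ck k I f : Prop :=
  if k is k'.+1 then (forall t, I t -> derivable f t 1) /\ Ck k' I (der f)
  else forall t, I t -> {for t, continuous f}.

Lemma derivable_cont f t : derivable f t 1 -> {for t, continuous f}.
Proof. by move=> /derivable1_diffP; exact: differentiable_continuous. Qed.

Lemma Ck_continuous k I f t : Ck k I f -> I t -> {for t, continuous f}.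
Proof. by case: k => [|k] /=; [exact|case=> + _ => /[apply]/derivable_cont]. Qed.

Lemma CkW k I f : Ck k.+1 I f -> Ck k I f.
Proof.
elim: k f => [|k IH] f; first by case=> h _ t /h /derivable_cont.
by case=> h1 /IH h2.
Qed.

Lemma Ck_leq k l I f : (k <= l)%N -> Ck l I f -> Ck k I f.
Proof.
move=> /subnKC <-; elim: (l - k)%N => [|d IH]; first by rewrite addn0.
by rewrite addnS => /CkW.
Qed.

Lemma Ck_iter k I f j : Ck (k + j) I f -> Ck k I (iter j der f).
Proof.
elim: j f => [|j IH] f; first by rewrite addn0.
by rewrite addnS iterSr => -[_ /IH].
Qed.

Lemma open_near I t (P : R -> Prop) : open I -> I t -> (forall s, I s -> P s) ->
  \forall s \near t, P s.
Proof. by move=> oI It IP; apply: filterS IP _; exact: open_nbhs_nbhs. Qed.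

Lemma near_eq_der f g t : (\forall s \near t, f s = g s) -> der f t = der g t.
Proof. by move=> fg; rewrite /der !derive1E; exact: near_eq_derive. Qed.

Lemma Ck_eq k I f g : open I -> (forall t, I t -> f t = g t) ->
  Ck k I f -> Ck k I g.
Proof.
move=> oI; elim: k f g => [|k IH] f g fg /=.
  move=> cf t It; have cft : f @ t --> f t := cf t It.
  suff : g @ t --> g t by []; rewrite -(fg _ It); move: cft.
  by apply: cvg_trans; apply: near_eq_cvg; apply: open_near It _ => // s Is; rewrite fg.
case=> df cf; split=> [t It|].
  by apply: near_eq_derivable (df t It); apply: open_near It _.
by apply: IH cf => t It; apply: near_eq_der; apply: open_near It _.
Qed.

Lemma Ck_cst k I (a : R) : Ck k I (cst a).
Proof.
elim: k a => [|k IH] a; first by move=> t _; exact: cst_continuous.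
split=> [t _|]; first exact: derivable_cst.
rewrite (_ : der _ = cst 0); first exact: IH.
by apply/funext => t; rewrite /der derive1_cst.
Qed.

Lemma Ck_add k I f g : open I -> Ck k I f -> Ck k I g -> Ck k I (fun t => f t + g t).
Proof.
move=> oI; elim: k f g => [|k IH] f g /=.
  by move=> cf cg t It; apply: continuousD; [exact: cf|exact: cg].
move=> [df cf] [dg cg]; split=> [t It|]; first by apply: derivableD; [exact: df|exact: dg].
apply: Ck_eq (IH _ _ cf cg) => // t It.
by have := is_deriveD (derP (df t It)) (derP (dg t It)) => -[_ <-]; rewrite /der derive1E.
Qed.

Lemma Ck_mul k I f g : open I -> Ck k I f -> Ck k I g -> Ck k I (fun t => f t * g t).
Proof.
move=> oI; elim: k f g => [|k IH] f g.
  by move=> cf cg t It; apply: continuousM; [exact: cf|exact: cg].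
move=> Cf Cg; have [df cf] := Cf; have [dg cg] := Cg.
split=> [t It|]; first by apply: derivableM; [exact: df|exact: dg].
have := Ck_add oI (IH _ _ (CkW Cf) cg) (IH _ _ (CkW Cg) cf).
apply: Ck_eq => // t It.
by have := is_deriveM (derP (df t It)) (derP (dg t It)) => -[_ <-]; rewrite /der derive1E.
Qed.

Lemma Ck_exp k I f n : open I -> Ck k I f -> Ck k I (fun t => f t ^+ n).
Proof.
move=> oI Cf; elim: n => [|n IH]; first exact: Ck_cst.
by apply: Ck_eq (Ck_mul oI Cf IH) => // t _; rewrite exprS.
Qed.

Lemma Ck_sum k I (T : Type) (s : seq T) (F : T -> R -> R) : open I ->
  (forall i, Ck k I (F i)) -> Ck k I (fun t => \sum_(i <- s) F i t).
Proof.
move=> oI CF; elim: s => [|i s IH].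
  by apply: Ck_eq (Ck_cst k I 0) => // t _; rewrite big_nil.
by apply: Ck_eq (Ck_add oI (CF i) IH) => // t _; rewrite big_cons.
Qed.

Lemma Ck_prod k I (T : Type) (s : seq T) (F : T -> R -> R) : open I ->
  (forall i, Ck k I (F i)) -> Ck k I (fun t => \prod_(i <- s) F i t).
Proof.
move=> oI CF; elim: s => [|i s IH].
  by apply: Ck_eq (Ck_cst k I 1) => // t _; rewrite big_nil.
by apply: Ck_eq (Ck_mul oI (CF i) IH) => // t _; rewrite big_cons.
Qed.

Lemma continuous_near_bounded f t : {for t, continuous f} ->
  exists2 B : R, 0 <= B & \forall s \near t, `|f s| <= B.
Proof.
move=> cf; exists (`|f t| + 1); first by rewrite addr_ge0.
have /cvgrPdist_le /(_ 1 ltr01) := cf; apply: filterS => s fts.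
rewrite -[f s](subrK (f t)) addrC (le_trans (ler_normD _ _))// lerD2l.
by rewrite distrC.
Qed.

Lemma cvg_dnbhs0 (F : R -> R) (l : R) :
  F h @[h --> 0] --> l -> F h @[h --> 0^'] --> l.
Proof. by apply: cvg_trans; apply: cvg_app; exact: cvg_within. Qed.

Lemma continuous_dnbhs f y : {for y, continuous f} ->
  f (y + h) @[h --> 0^'] --> f y.
Proof.
move=> cf; apply: cvg_dnbhs0; apply/cvgrPdist_le => e e0.
have /cvgrPdist_le /(_ e e0) /nearP[d d0 dP] := cf.
by apply/nearP; exists d => // h; rewrite subr0 => hd; apply: dP; rewrite addrC addKr.
Qed.

(** Induction on [n]. By [interpolation] on the interval between [y + h] and
[y + 2 h], the derivative is [O(h^n)] when [f] is [O(h^(n+1))], so [f' / h^n]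
has a limit [L]; integrating, [f / h^(n+1)] tends to [L / (n + 1)]. *)
Lemma power_quotient_cvg n f I y : open I -> I y -> Ck n I f ->
  (exists C : R, \forall h \near 0^', `|f (y + h)| <= C * `|h| ^+ n) ->
  exists L : R, f (y + h) / h ^+ n @[h --> 0^'] --> L.
Proof.
move=> oI Iy; elim: n f => [|n IH] f.
  move=> cf _; exists (f y); under eq_fun do rewrite expr0 divr1.
  by apply: continuous_dnbhs; exact: cf.
move=> Cf [C0 fC]; have [df Cdf] := Cf.
pose C : R := `|C0|.
have {fC}[e1 e10 fC] : exists2 e1 : R, 0 < e1 & forall h : R, h != 0 -> `|h| < e1 ->
    `|f (y + h)| <= C * `|h| ^+ n.+1.
  have [e1 e10 e1P] := (dnearP _).1 fC; exists e1 => // h h0 he.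
  by apply: le_trans (e1P h h0 he) _; rewrite ler_wpM2r ?exprn_ge0// ler_norm.
have [e2 e20 Ie2] : exists2 e : R, 0 < e & forall t, `|t - y| < e -> I t.
  by apply/nearP; apply: open_near Iy _.
have [B B0 /nearP[e3 e30 fB]] :
    exists2 B : R, 0 <= B & \forall s \near y, `|iter n.+1 der f s| <= B.
  apply: continuous_near_bounded.
  by apply: (@Ck_continuous 0%N I) => //; apply: Ck_iter; rewrite add0n.
have fy0 : f y = 0.
  have cf : `|f (y + h)| @[h --> 0^'] --> `|f y|.
    by apply: cvg_norm; apply: continuous_dnbhs; exact/derivable_cont/df.
  have c0 : C * `|h| ^+ n.+1 @[h --> (0 : R)^'] --> C * `|0 : R| ^+ n.+1.
    apply: (@cvg_dnbhs0 (fun h => C * `|h| ^+ n.+1)); apply: cvgM; first exact: cvg_cst.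
    apply: (@continuous_comp _ _ _ _ (fun x : R => x ^+ n.+1)).
      exact: norm_continuous.
    exact: exprn_continuous.
  have := ler_cvg_to cf c0; rewrite normr0 expr0n mulr0 normr_le0 => h.
  by apply/eqP/h; apply/dnearP; exists e1 => // ? ? ?; exact: fC.
have [K K0 KP] := interpolation R n.
have [||L HL] := IH (der f).
- exact: Cdf.
- exists (K * (C * 2 ^+ n.+1 + B)); apply/dnearP.
  (* Half of the minimum, as the interval between y + h and y + 2 h is used. *)
  pose e := Num.min e1 (Num.min e2 e3).
  exists (e / 2); first by rewrite divr_gt0// !lt_min e10 e20.
  move=> h h0 he.
  have he2 : 2 * `|h| < e by rewrite mulrC -ltr_pdivlMr.
  have [he_1 he_2 he_3] : [/\ 2 * `|h| < e1, 2 * `|h| < e2 & 2 * `|h| < e3].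
    by move: he2; rewrite !lt_min => /and3P[].
  have hn : 0 < `|h| by rewrite normr_gt0.
  (* The left end of the interval between y + h and y + 2 h. *)
  pose x := if 0 < h then y + h else y + 2 * h.
  have xP t : x <= t <= x + `|h| -> t != y /\ `|t - y| <= 2 * `|h|.
    rewrite /x; case: (ltrgt0P h) (h0) (hn) => // h1 _ hn' /andP[t1 t2]; split.
    - by rewrite gt_eqF//; lra.
    - by rewrite ger0_norm; lra.
    - by rewrite lt_eqF//; lra.
    - by rewrite ler0_norm; lra.
  have := KP f x `|h| (C * (2 * `|h|) ^+ n.+1) B hn.
  have -> : K * (C * (2 * `|h|) ^+ n.+1 / `|h| + B * `|h| ^+ n) =
            K * (C * 2 ^+ n.+1 + B) * `|h| ^+ n.
    by rewrite exprMn (exprS `|h|); field; rewrite lt0r_neq0.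
  apply => //.
  + by apply: mulr_ge0; [exact: normr_ge0|exact/exprn_ge0/mulr_ge0].
  + move=> j t jn /xP[_ ty].
    have : Ck 1 I (iter j der f) by apply: Ck_iter; apply: Ck_leq Cf.
    by case=> + _; apply; apply: Ie2; exact: le_lt_trans ty _.
  + move=> t /xP[t0 ty].
    have := fC (t - y); rewrite subr_eq0 t0 => /(_ isT (le_lt_trans ty he_1)).
    rewrite addrC subrK => /le_trans; apply; apply: ler_wpM2l; first exact: normr_ge0.
    by apply: lerXn2r => //; rewrite nnegrE ?mulr_ge0.
  + by move=> t /xP[_ ty]; apply: fB; exact: le_lt_trans ty _.
  + rewrite /x; case: (ltrgt0P h) h0 hn => // h1 _ _; apply/andP; split; lra.
have n0 : n.+1%:R != 0 :> R by rewrite pnatr_eq0.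
exists (L / n.+1%:R); apply/cvgrPdist_le => e e0.
have /cvgrPdist_le /(_ e e0) /dnearP[d d0 dP] := HL.
apply/dnearP; exists (Num.min d e2); first by rewrite lt_min d0.
move=> h h0; rewrite lt_min => /andP[hd he2].
pose g t := f t - L / n.+1%:R * (t - y) ^+ n.+1.
have dg t : derivable f t 1 -> is_derive t 1 g (der f t - L * (t - y) ^+ n).
  move=> /derP dft; rewrite /g.
  have -> : (fun t => f t - L / n.+1%:R * (t - y) ^+ n.+1) =
    (f - (L / n.+1%:R) *: ((id - cst y) ^+ n.+1)).
    by apply/funext => s; rewrite !fctE.
  apply: is_derive_eq.
  rewrite /= subr0 !fctE; congr (_ - _); rewrite -mulr_natl.
  rewrite [_%:A]mulr1 [_ *: _]mulrA.
  by rewrite !mulr1 divfK.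
have near_y t : Num.min y (y + h) <= t <= Num.max y (y + h) -> `|t - y| <= `|h|.
  case: (ltrgt0P h) h0 => // h1 _; case: (leP y) => // h2 /andP[? ?]; try lra.
    by rewrite ger0_norm; lra.
  by rewrite ler0_norm; lra.
have := @mean_value_dist _ g y (y + h) (e * `|h| ^+ n).
have -> : y + h - y = h by rewrite addrC addKr.
move=> mv; have {mv} : `|g (y + h) - g y| <= e * `|h| ^+ n * `|h|.
  apply: mv => t ty.
    have [|//] := dg t _; apply: df; apply: Ie2.
    by apply: le_lt_trans he2; exact: near_y.
  have ty' : `|t - y| <= `|h|.
    by apply: near_y; case/andP: ty => ? ?; rewrite !ltW.
  rewrite /der derive1E; have [_ ->] := dg t (df t (Ie2 t (le_lt_trans ty' he2))).
  have t0 : t - y != 0.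
    by rewrite subr_eq0; apply: contraTneq ty => ->; case: (leP y (y + h)) => _; rewrite ltxx ?andbF.
  have := dP (t - y) t0 (le_lt_trans ty' hd); rewrite [y + _]addrC subrK => dt.
  have -> : der f t - L * (t - y) ^+ n = - ((L - der f t / (t - y) ^+ n) * (t - y) ^+ n).
    by rewrite mulrBl divfK ?expf_neq0// opprB.
  rewrite normrN normrM normrX ler_pM ?exprn_ge0//.
  by apply: lerXn2r => //; rewrite nnegrE.
have -> : g y = 0 by rewrite /g fy0 subrr expr0n mulr0 subr0.
have -> : g (y + h) = f (y + h) - L / n.+1%:R * h ^+ n.+1.
  by rewrite /g [y + h]addrC addrK.
have hn0 : h ^+ n.+1 != 0 by rewrite expf_neq0.
rewrite subr0 -[e * _ * _]mulrA -exprSr.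
have -> : f (y + h) - L / n.+1%:R * h ^+ n.+1 =
    - ((L / n.+1%:R - f (y + h) / h ^+ n.+1) * h ^+ n.+1).
  by rewrite mulrBl divfK// opprB.
by rewrite normrN normrM normrX ler_pM2r// exprn_gt0// normr_gt0.
Qed.

End Smooth.

(** * Nonnegative functions and their roots *)

Section RootBound.
Variable R : realType.
Implicit Types (r f : R -> R) (I : set R) (t h : R).

Lemma near_second_order I r t0 : open I -> I t0 -> Ck 2 I r ->
  exists2 M : R, 0 <= M & exists2 e : R, 0 < e & forall t h, `|t - t0| < e -> `|h| < e ->
    I (t + h) /\ `|r (t + h) - r t - der r t * h| <= M * h ^+ 2.
Proof.
move=> oI It0 [dr [ddr cddr]].
have [M M0 /nearP[e1 e10 rM]] := continuous_near_bounded (cddr t0 It0).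
have [e2 e20 Ie2] : exists2 e : R, 0 < e & forall t, `|t - t0| < e -> I t.
  by apply/nearP; apply: open_near It0 _.
exists M => //; pose e := Num.min e1 e2.
exists (e / 2); first by rewrite divr_gt0// lt_min e10.
move=> t h te he.
have sub s : Num.min t (t + h) <= s <= Num.max t (t + h) ->
    `|s - t0| < e1 /\ `|s - t0| < e2.
  move=> sth; have : `|s - t0| < e.
    have st : `|s - t| <= `|h|.
      move: sth; case: (leP t) => th /andP[h1 h2].
        by rewrite !ger0_norm; lra.
      by rewrite !ler0_norm; lra.
    have -> : s - t0 = (s - t) + (t - t0) by rewrite addrA subrK.
    by apply: le_lt_trans (ler_normD _ _) _; lra.
  by rewrite lt_min => /andP.
have Mth : Num.min t (t + h) <= t + h <= Num.max t (t + h).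
  by case: (leP t) => [|/ltW] ->; rewrite lexx.
split; first by apply: Ie2; have [] := sub _ Mth.
have := @first_order_dist _ r t (t + h) M M0.
have -> : t + h - t = h by rewrite addrC addKr.
rewrite real_normK ?num_real//; apply => s /sub[s1 s2].
- by apply: dr; exact: Ie2.
- by apply: ddr; exact: Ie2.
- exact: rM.
Qed.

(** A nonnegative function cannot have a large slope where it is small: both
[r (t + h)] and [r (t - h)] are nonnegative and the linear term changes sign. *)
Lemma glaeser r t h M : 0 <= r (t + h) -> 0 <= r (t - h) ->
  `|r (t + h) - r t - der r t * h| <= M * h ^+ 2 ->
  `|r (t - h) - r t - der r t * (- h)| <= M * h ^+ 2 ->
  `|der r t * h| <= r t + M * h ^+ 2.
Proof.
rewrite mulrN !ler_norml => r1 r2 /andP[h1 h2] /andP[h3 h4].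
by apply/andP; split; lra.
Qed.

(** At a zero of a nonnegative [C^2] function the derivative vanishes, by
[glaeser] with a step tending to [0]. *)
Lemma zero_quadratic I r t0 : open I -> I t0 -> Ck 2 I r ->
  (forall t, I t -> 0 <= r t) ->
  exists2 M : R, 0 <= M & exists2 e : R, 0 < e &
    forall t h, `|t - t0| < e -> `|h| < e -> r t = 0 -> r (t + h) <= M * h ^+ 2.
Proof.
move=> oI It0 Cr r0; have [M M0 [e e0 eM]] := near_second_order oI It0 Cr.
exists M => //; exists e => // t h te he rt0.
have dr0 : der r t = 0.
  apply/eqP; rewrite -normr_le0; apply/ler_addgt0Pr => d d0; rewrite add0r.
  pose s := Num.min (e / 2) (d / (M + 1)).
  have M1 : 0 < M + 1 by rewrite ltr_wpDl.
  have s0 : 0 < s by rewrite lt_min !divr_gt0.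
  have se : `|s| < e.
    rewrite gtr0_norm//; apply: (@le_lt_trans _ _ (e / 2)); last lra.
    by rewrite ge_min lexx.
  have se' : `|- s| < e by rewrite normrN.
  have [I1 h1] := eM t s te se; have [I2 h2] := eM t (- s) te se'.
  rewrite sqrrN in h2.
  have := glaeser (r0 _ I1) (r0 _ I2) h1 h2.
  rewrite rt0 add0r normrM (gtr0_norm s0) expr2 mulrA ler_pM2r// => /le_trans; apply.
  apply: (@le_trans _ _ ((M + 1) * s)); first by rewrite ler_wpM2r ?lerDl// ltW.
  by rewrite mulrC -ler_pdivlMr// ge_min lexx orbT.
have [_] := eM t h te he; rewrite rt0 dr0 mul0r !subr0.
by apply: le_trans; exact: ler_norm.
Qed.

(** Choose the step [h = c * sqrt (r t)]. By [glaeser] the slope of [r] at [t] is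
[O(sqrt (r t))], so [r] is at most [Q^2 * r t] on the interval from [t] to
[t + h] and [|f|] is at most [(Q * sqrt (r t))^(k+2)] there; [interpolation] on
this interval gives the claim. The constant [c] keeps the interval inside the
neighbourhood of [t0] where the bounds on the derivatives hold. *)
Lemma root_bound k I r f t0 : open I -> I t0 -> Ck k.+2 I r -> Ck k.+2 I f ->
  (forall t, I t -> 0 <= r t) -> (forall t, I t -> f t ^+ 2 <= r t ^+ k.+2) ->
  exists2 C : R, 0 <= C &
    \forall t \near t0, 0 < r t -> `|der f t| <= C * Num.sqrt (r t) ^+ k.+1.
Proof.
move=> oI It0 Cr Cf r0 fr.
have [M M0 [e e0 eM]] := near_second_order oI It0 (Ck_leq (leq_addr k 2) Cr).
have [A A0 rA] := continuous_near_bounded (Ck_continuous Cr It0).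
have [B B0 /nearP[e1 e10 fB]] :
    exists2 B : R, 0 <= B & \forall s \near t0, `|iter k.+2 der f s| <= B.
  apply: continuous_near_bounded.
  by apply: (@Ck_continuous _ 0%N I) => //; apply: Ck_iter; rewrite add0n.
have [K K0 KP] := interpolation R k.+1.
pose d := Num.min e (e1 / 2); have d0 : 0 < d by rewrite lt_min e0 divr_gt0.
pose c := Num.min 1 (d / (2 * (A + 1))).
have A1 : 0 < A + 1 by rewrite ltr_wpDl.
have c0 : 0 < c by rewrite lt_min ltr01 divr_gt0// mulr_gt0.
have c1 : c <= 1 by rewrite ge_min lexx.
have cA : c * (A + 1) < d.
  apply: (@le_lt_trans _ _ (d / 2)); last lra.
  by rewrite -ler_pdivlMr// -mulrA -invfM ge_min lexx orbT.
pose Q := Num.sqrt (2 + 2 * M).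
have Q2 : Q ^+ 2 = 2 + 2 * M by rewrite sqr_sqrtr// addr_ge0// mulr_ge0.
exists (K * (Q ^+ k.+2 / c + B)).
  by rewrite mulr_ge0// addr_ge0// divr_ge0 ?exprn_ge0 ?sqrtr_ge0// ltW.
have te : \forall t \near t0, `|t - t0| < d by apply/nearP; exists d.
near=> t => rt0.
have ttd : `|t - t0| < d by near: t.
have tte : `|t - t0| < e by apply: lt_le_trans ttd _; rewrite ge_min lexx.
have tte1 : `|t - t0| < e1 / 2 by apply: lt_le_trans ttd _; rewrite ge_min lexx orbT.
pose q := Num.sqrt (r t).
have q0 : 0 < q by rewrite sqrtr_gt0.
have qr : q ^+ 2 = r t by rewrite sqr_sqrtr// ltW.
have qA : q <= A + 1.
  have : r t <= A by apply: le_trans (ler_norm _) _; near: t.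
  by rewrite -qr; nra.
pose h := c * q; have h0 : 0 < h by rewrite mulr_gt0.
have hd : h < d by apply: le_lt_trans cA; rewrite ler_wpM2l// ltW.
have hq : h <= q by rewrite ler_piMl// ltW.
have he : `|h| < e by rewrite gtr0_norm//; apply: lt_le_trans hd _; rewrite ge_min lexx.
have h2r : h ^+ 2 <= r t by rewrite -qr; apply: lerXn2r; rewrite ?nnegrE// ltW.
have dr : `|der r t| * h <= r t + M * h ^+ 2.
  have he' : `|- h| < e by rewrite normrN.
  have [I1 h1] := eM t h tte he; have [I2 h2] := eM t (- h) tte he'.
  rewrite sqrrN in h2.
  by have := glaeser (r0 _ I1) (r0 _ I2) h1 h2; rewrite normrM (gtr0_norm h0).
have grow s : 0 <= s <= h -> I (t + s) /\ r (t + s) <= (Q * q) ^+ 2.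
  move=> /andP[s0 sh].
  have se : `|s| < e.
    by apply: le_lt_trans he; rewrite ger0_norm// ger0_norm// ltW.
  have [Is] := eM t s tte se; rewrite ler_norml => /andP[_ rs]; split => //.
  rewrite exprMn Q2 qr.
  have : der r t * s <= `|der r t| * h.
    apply: le_trans (ler_norm _) _; rewrite normrM (ger0_norm s0).
    exact: ler_wpM2l.
  have : M * s ^+ 2 <= M * h ^+ 2.
    by rewrite ler_wpM2l// lerXn2r// nnegrE// ltW.
  have : M * h ^+ 2 <= M * r t by rewrite ler_wpM2l.
  lra.
have Qq0 : 0 <= Q * q by rewrite mulr_ge0// ?sqrtr_ge0.
have {}grow s : t <= s <= t + h -> I s /\ r s <= (Q * q) ^+ 2.
  move=> /andP[? ?]; have := grow (s - t); rewrite [t + _]addrC subrK; apply.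
  by apply/andP; split; lra.
have := KP f t h ((Q * q) ^+ k.+2) B h0 (exprn_ge0 _ Qq0) B0.
have -> : K * ((Q * q) ^+ k.+2 / h + B * h ^+ k.+1) =
    K * (Q ^+ k.+2 / c + B * c ^+ k.+1) * q ^+ k.+1.
  by rewrite /h !exprMn [q ^+ k.+2]exprS; field; rewrite !gt_eqF.
move=> KPt.
have : `|der f t| <= K * (Q ^+ k.+2 / c + B * c ^+ k.+1) * q ^+ k.+1.
  apply: KPt.
  - move=> j s jk /grow[Is _].
    have : Ck 1 I (iter j der f) by apply: Ck_iter; apply: Ck_leq Cf.
    by case=> + _; apply.
  - move=> s /grow[Is rs].
    rewrite -ler_sqr ?nnegrE ?exprn_ge0// real_normK ?num_real//.
    apply: le_trans (fr s Is) _; rewrite -exprM mulnC exprM.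
    by apply: lerXn2r => //; rewrite nnegrE ?r0 ?exprn_ge0.
  - move=> s /andP[ts sh]; apply: fB.
    have -> : s - t0 = (s - t) + (t - t0) by rewrite addrA subrK.
    apply: le_lt_trans (ler_normD _ _) _; rewrite ger0_norm ?subr_ge0//.
    have : h < e1 / 2 by apply: lt_le_trans hd _; rewrite ge_min lexx orbT.
    lra.
  - by rewrite lexx lerDl ltW.
move=> /le_trans; apply; apply: ler_wpM2r; first exact/exprn_ge0/ltW.
apply: ler_wpM2l => //; rewrite lerD2l ler_piMr// exprn_ile1// ltW.
Unshelve. all: by end_near.
Qed.
End RootBound.

(** * Monodromy on the line *)

Section Monodromy.
Variables (R : realType) (X : Type) (x0 : X) (O : set R) (P : (R -> X) -> R -> Prop).
Variable G : set (X -> X).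
Implicit Types (w : R -> X) (t x y z p : R) (A : set R).

(* P w t says that the germ of w at t is a lift, and the maps in G are the
   transitions between lifts. *)
Hypothesis openO : open O.
Hypothesis P_germ : forall w w' t, (\forall s \near t, w s = w' s) -> P w t -> P w' t.
Hypothesis P_act : forall g w t, G g -> P w t -> P (g \o w) t.
Hypothesis P_loc : forall t, O t -> exists w, \forall s \near t, P w s.
Hypothesis P_trans : forall t w w', O t ->
  (\forall s \near t, P w s) -> (\forall s \near t, P w' s) ->
  exists2 g, G g & \forall s \near t, w s = g (w' s).
Hypothesis P_rigid : forall t w w', O t ->
  (\forall s \near t, P w s) -> (\forall s \near t, P w' s) ->
  closure [set s : R | \forall u \near s, w u = w' u] t ->
  \forall s \near t, w s = w' s.

Definition lift_on A w := [/\ open A, is_interval A, A `<=` O & forall t, A t -> P w t].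

Definition linked x y := exists A w, [/\ lift_on A w, A x & A y].

Lemma lift_near A w t : lift_on A w -> A t -> \forall s \near t, P w s.
Proof. by move=> [oA _ _ Pw] At; apply: open_near At _. Qed.

(** The set where the two lifts have the same germ is open, and by rigidity closed,
in the interval common to both domains. *)
Lemma lift_unique A w A' w' p : lift_on A w -> lift_on A' w' -> A p -> A' p ->
  (\forall s \near p, w s = w' s) ->
  forall t, A t -> A' t -> w t = w' t.
Proof.
move=> L L' Ap A'p wp.
have [oA iA AO _] := L; have [_ iA' _ _] := L'.
pose C : set R := [set s : R | \forall u \near s, w u = w' u].
have cD : connected (A `&` A').
  apply/connected_intervalP => a b [Aa A'a] [Ab A'b] c acb.
  by split; [exact: (iA a b)|exact: (iA' a b)].
have /(cD (A `&` A' `&` C)) E : A `&` A' `&` C !=set0 by exists p.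
move=> t At A't; suff [_ /nbhs_singleton] : (A `&` A' `&` C) t by [].
rewrite E//.
- by exists C => //; exact: open_interior.
- exists (closure C); first exact: closed_closure.
  apply/seteqP; split=> s [As Cs]; split=> //; first exact: subset_closure.
  case: As => As A's; apply: P_rigid Cs; first exact: AO.
    exact: lift_near L As.
  exact: lift_near L' A's.
Qed.

Lemma linked_sym x y : linked x y -> linked y x.
Proof. by move=> [A [w [L Ax Ay]]]; exists A, w. Qed.

(** After a transition at [y] the lift [w'] agrees with [w] near [y], so that
the two can be pasted there. *)
Lemma lift_paste A w A' w' x y z : lift_on A w -> lift_on A' w' ->
  A x -> A y -> A' y -> A' z -> x < y -> y < z -> linked x z.
Proof.
move=> L L' Ax Ay A'y A'z xy yz.
have [oA iA AO PA] := L; have [oA' iA' AO' PA'] := L'.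
have [g Gg wg] := P_trans (AO _ Ay) (lift_near L Ay) (lift_near L' A'y).
(* The overlap makes the domain a neighbourhood of y. *)
pose B := (A `&` [set t | t < y]) `|` (A' `&` [set t | y < t]) `|` (A `&` A').
have BA t : B t -> t <= y -> A t.
  by move=> [[[]|[_ /=]]|[]]// yt; rewrite leNgt yt.
have BA' t : B t -> y <= t -> A' t.
  by move=> [[[_ /=]|[]]|[]]// yt; rewrite leNgt yt.
exists B, (fun t => if t <= y then w t else g (w' t)); split; last 2 first.
- by left; left.
- by left; right.
split.
- apply: openU; last exact: openI.
  by apply: openU; apply: openI.
- move=> a b Ba Bb c /andP[ac cb]; case: (ltgtP c y) => cy.
  + left; left; split=> //; apply: (iA a y) => //; last by rewrite ac ltW.
    by apply: BA => //; rewrite (le_trans ac)// ltW.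
  + left; right; split=> //; apply: (iA' y b) => //; last by rewrite cb ltW.
    by apply: BA' => //; rewrite (le_trans _ cb)// ltW.
  + by rewrite cy; right.
- by move=> t [[[/AO]|[/AO']]|[/AO]].
- move=> t Bt; case: (ltgtP t y) => ty.
  + apply: P_germ (PA t (BA t Bt (ltW ty))).
    have : \forall s \near t, s < y by exact: lt_nbhsl.
    by apply: filterS => s sy; rewrite ltW.
  + apply: P_germ (P_act Gg (PA' t (BA' t Bt (ltW ty)))).
    have : \forall s \near t, y < s by exact: lt_nbhsr.
    by apply: filterS => s sy; rewrite leNgt sy.
  + rewrite ty; apply: P_germ (PA y Ay).
    by apply: filterS wg => s ws; case: ifP.
Qed.

Lemma linked_trans x y z : linked x y -> linked y z -> linked x z.
Proof.
move=> [A [w [L Ax Ay]]] [A' [w' [L' A'y A'z]]].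
have [_ iA _ _] := L; have [_ iA' _ _] := L'.
have [Az|nAz] := pselect (A z); first by exists A, w.
have [A'x|nA'x] := pselect (A' x); first by exists A', w'.
case: (ltgtP x y) => xy; last by case: nA'x; rewrite xy.
- case: (ltgtP y z) => yz; last by case: nAz; rewrite -yz.
    exact: (lift_paste L L' Ax Ay A'y A'z).
  case: (leP x z) => xz.
    by case: nAz; apply: (iA x y) => //; rewrite xz ltW.
  by case: nA'x; apply: (iA' z y) => //; rewrite !ltW.
- case: (ltgtP y z) => yz; last by case: nAz; rewrite -yz.
    case: (leP x z) => xz.
      by case: nA'x; apply: (iA' y z) => //; rewrite xz ltW.
    by case: nAz; apply: (iA y x) => //; rewrite !ltW.
  apply: linked_sym; exact: (lift_paste L' L A'z A'y Ay Ax).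
Qed.

Lemma linked_refl x : O x -> linked x x.
Proof.
move=> Ox; have [w] := P_loc Ox => wP.
have /nearP[e e0 eP] : \forall s \near x, O s /\ P w s.
  by apply: filterI wP; exact: open_nbhs_nbhs.
exists (ball x e), w; split; try exact: ballxx.
have bP t : ball x e t -> O t /\ P w t by rewrite /ball/= distrC; exact: eP.
split=> [|a b|t /bP[]//|t /bP[]//]; first exact: ball_open.
by rewrite ball_itv => xa xb c acb; apply: (interval_is_interval xa xb).
Qed.

(** Choose a base point in each class of linked points and a germ of lift at this
base point. Each point lies, together with its base point, in the domain of
a lift with the chosen germ; its value at the point is independent of the choice
by [lift_unique], and the values so obtained agree locally with one lift. *)
Lemma monodromy : exists w, forall t, O t -> P w t.
Proof.
have /choice[germ germP] : forall p, exists w, O p -> \forall s \near p, P w s.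
  move=> p; have [/P_loc[w wP]|nOp] := pselect (O p); first by exists w.
  by exists (cst x0).
pose base x := xget 0 (linked x).
have baseP x : O x -> linked x (base x).
  by move=> /linked_refl xx; apply: xgetPex; exists x.
have base_eq x y : linked x y -> base x = base y.
  move=> xy; congr xget; apply/seteqP; split=> z; last exact: linked_trans.
  by apply: linked_trans; exact: linked_sym.
have /choice[Aw AwP] : forall x, exists Aw : set R * (R -> X), O x ->
    [/\ lift_on Aw.1 Aw.2, Aw.1 x, Aw.1 (base x) &
     \forall s \near base x, Aw.2 s = germ (base x) s].
  move=> x; have [Ox|nOx] := pselect (O x); last by exists (set0, cst x0).
  have [A [w [L Ax Ab]]] := baseP x Ox; have [oA iA AO PA] := L.
  have [g Gg wg] := P_trans (AO _ Ab) (germP _ (AO _ Ab)) (lift_near L Ab).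
  exists (A, g \o w) => _; split=> //=; last by apply: filterS wg => s ->.
  by split=> // t At; apply: P_act => //; exact: PA.
exists (fun x => (Aw x).2 x) => x Ox.
have [L Ax Ab wb] := AwP x Ox; have [oA iA AO PA] := L.
apply: P_germ (PA x Ax); apply: (open_near oA Ax) => // y Ay.
have [L' A'y A'b wb'] := AwP y (AO _ Ay).
have bxy : base x = base y.
  apply: base_eq; exists (Aw x).1, (Aw x).2; by split.
rewrite -bxy in A'b wb'.
apply: (lift_unique L L' Ab A'b) => //.
by apply: filterS2 wb wb' => s -> ->.
Qed.

End Monodromy.

(** * Complex functions and roots of unity *)

Section ComplexCurves.
Variable R : realType.
Local Notation C := R[i].
Implicit Types (w : R -> C) (t x h : R) (z u : C).

Definition normsq z : R := re z ^+ 2 + im z ^+ 2.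

Lemma reM z u : re (z * u) = re z * re u - im z * im u.
Proof. by case: z u => [? ?] []. Qed.

Lemma imM z u : im (z * u) = re z * im u + im z * re u.
Proof. by case: z u => [? ?] []. Qed.

Lemma reB z u : re (z - u) = re z - re u.
Proof. by case: z u => [? ?] []. Qed.

Lemma imB z u : im (z - u) = im z - im u.
Proof. by case: z u => [? ?] []. Qed.

Lemma reV z : re z^-1 = re z / normsq z.
Proof. by case: z. Qed.

Lemma imV z : im z^-1 = - im z / normsq z.
Proof. by case: z => a b; rewrite /= mulNr. Qed.

Lemma complex_eq z u : re z = re u -> im z = im u -> z = u.
Proof. by case: z u => [? ?] [? ?] /= -> ->. Qed.

Lemma normsqM z u : normsq (z * u) = normsq z * normsq u.
Proof. by rewrite /normsq reM imM; ring. Qed.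

Lemma normsq1 : normsq 1 = 1.
Proof. by rewrite /normsq /= expr0n addr0 expr1n. Qed.

Lemma normsqX z n : normsq (z ^+ n) = normsq z ^+ n.
Proof. by elim: n => [|n IH]; rewrite ?normsq1// !exprS normsqM IH. Qed.

Lemma normsq_ge0 z : 0 <= normsq z.
Proof. by rewrite addr_ge0// sqr_ge0. Qed.

Lemma normsq_eq0 z : (normsq z == 0) = (z == 0).
Proof. by rewrite paddr_eq0 ?sqr_ge0// !sqrf_eq0 eq_complex. Qed.

Lemma normsq_gt0 z : (0 < normsq z) = (z != 0).
Proof. by rewrite lt0r normsq_eq0 normsq_ge0 andbT. Qed.

Lemma normc_normsq z : `|z| = (Num.sqrt (normsq z))%:C%C.
Proof. exact: normc_def. Qed.

(** Convergence of complex functions is handled through real and imaginary parts. *)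
Definition ccvg (F : set_system R) w z :=
  re (w x) @[x --> F] --> re z /\ im (w x) @[x --> F] --> im z.

Lemma ccvg_cst (F : set_system R) {FF : Filter F} z : ccvg F (cst z) z.
Proof. by split; exact: cvg_cst. Qed.

Lemma ccvgM (F : set_system R) {FF : Filter F} w w' z z' :
  ccvg F w z -> ccvg F w' z' -> ccvg F (fun x => w x * w' x) (z * z').
Proof.
move=> [a b] [a' b']; split.
  by under eq_fun do rewrite reM; rewrite reM; apply: cvgB; exact: cvgM.
by under eq_fun do rewrite imM; rewrite imM; apply: cvgD; exact: cvgM.
Qed.

Lemma ccvgX (F : set_system R) {FF : Filter F} w z n :
  ccvg F w z -> ccvg F (fun x => w x ^+ n) (z ^+ n).
Proof.
move=> wz; elim: n => [|n IH].
  by under [X in ccvg _ X]eq_fun do rewrite expr0; exact: ccvg_cst.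
by under [X in ccvg _ X]eq_fun do rewrite exprS; rewrite exprS; exact: ccvgM.
Qed.

Lemma cvg_normsq (F : set_system R) {FF : Filter F} w z :
  ccvg F w z -> normsq (w x) @[x --> F] --> normsq z.
Proof. by move=> [a b]; apply: cvgD; exact: cvgM. Qed.

Lemma ccvgV (F : set_system R) {FF : Filter F} w z : z != 0 ->
  ccvg F w z -> ccvg F (fun x => (w x)^-1) z^-1.
Proof.
move=> z0 wz; have nz : normsq z != 0 by rewrite normsq_eq0.
have c : (normsq (w x))^-1 @[x --> F] --> (normsq z)^-1.
  exact: cvgV nz (cvg_normsq wz).
case: wz => a b; split.
  under eq_fun do rewrite reV; by rewrite reV; exact: cvgM a c.
by under eq_fun do rewrite imV; rewrite imV; exact: cvgM (cvgN b) c.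
Qed.

Lemma ccvg_unique (F : set_system R) {FF : ProperFilter F} w z u :
  ccvg F w z -> ccvg F w u -> z = u.
Proof.
by move=> [a b] [c d]; apply: complex_eq; [exact: cvg_unique a c|exact: cvg_unique b d].
Qed.

Lemma ccvg_near (F : set_system R) {FF : Filter F} w w' z :
  (\forall x \near F, w x = w' x) -> ccvg F w z -> ccvg F w' z.
Proof.
move=> ww' [a b]; split.
  apply: cvg_trans a; apply: near_eq_cvg; by apply: filterS ww' => x ->.
apply: cvg_trans b; apply: near_eq_cvg; by apply: filterS ww' => x ->.
Qed.

Lemma cvg_normsq_lt (F : set_system R) {FF : Filter F} w z (e : R) : 0 < e ->
  ccvg F w z -> \forall x \near F, normsq (w x - z) < e.
Proof.
move=> e0 wz.
have c0 : normsq (w x - z) @[x --> F] --> normsq 0.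
  rewrite -(subrr z); apply: cvg_normsq; case: wz => a b; split.
    by under eq_fun do rewrite reB; rewrite reB; apply: cvgB => //; exact: cvg_cst.
  by under eq_fun do rewrite imB; rewrite imB; apply: cvgB => //; exact: cvg_cst.
have n0 : normsq (0 : C) = 0 by apply/eqP; rewrite normsq_eq0.
by rewrite n0 in c0; apply: (cvgr_lt (0 : R) c0).
Qed.

Lemma ccvg_neq0 (F : set_system R) {FF : Filter F} w z : z != 0 ->
  ccvg F w z -> \forall x \near F, w x != 0.
Proof.
rewrite -normsq_gt0 => z0 wz; apply: filterS (cvg_normsq_lt z0 wz) => x; apply: contraTneq => ->.
by rewrite sub0r -leNgt /normsq; case: z z0 wz => a b _ _ /=; rewrite !sqrrN.
Qed.

(** If [u <> 1] then [1 + u + ... + u^(n-1) = 0], while each summand is at distance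
at most [n * |u - 1| < 1] from [1]. *)
Lemma unity_root_near1 u n : (0 < n)%N -> u ^+ n = 1 ->
  normsq (u - 1) < n%:R^-2 -> u = 1.
Proof.
move=> n0 un1 un; have nR : 0 < n%:R :> R by rewrite ltr0n.
have {}un : `|u - 1| < n%:R^-1.
  rewrite normc_normsq.
  have -> : n%:R^-1 = (n%:R^-1 : R)%:C%C :> C by rewrite fmorphV rmorph_nat.
  rewrite ltcR -ltr_sqr ?nnegrE ?sqrtr_ge0 ?invr_ge0 ?ler0n//.
  by rewrite sqr_sqrtr ?normsq_ge0// exprVn.
have u1 : `|u| = 1.
  by apply/eqP; rewrite -(pexpr_eq1 n0)// -normrX un1 normr1.
have ui i : `|u ^+ i - 1| <= i%:R * `|u - 1|.
  elim: i => [|i IH]; first by rewrite expr0 subrr normr0 mul0r.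
  have -> : u ^+ i.+1 - 1 = u * (u ^+ i - 1) + (u - 1) by rewrite exprS; ring.
  rewrite (le_trans (ler_normD _ _))// normrM u1 mul1r -natr1 mulrDl mul1r.
  by rewrite lerD2r.
apply/eqP; rewrite -subr_eq0; apply: contraLR un => u0.
have s0 : \sum_(i < n) u ^+ i = 0.
  by apply/(mulfI u0); rewrite -subrX1 un1 subrr mulr0.
have nE : n%:R = \sum_(i < n) (1 - u ^+ i).
  by rewrite sumrB s0 subr0 sumr_const card_ord.
have : (n%:R : C) <= n%:R * (n%:R * `|u - 1|).
  rewrite -[leLHS]ger0_norm ?ler0n// nE (le_trans (ler_norm_sum _ _ _))//.
  rewrite -nE [leRHS]mulr_natl -[X in _ *+ X]card_ord -sumr_const.
  apply: ler_sum => i _; rewrite distrC (le_trans (ui i))// ler_wpM2r//.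
  by rewrite ler_nat ltnW.
have nC : 0 < n%:R :> C by rewrite ltr0n.
rewrite ler_pMr// => h1.
have h2 : n%:R^-1 <= `|u - 1| by rewrite -(ler_pM2l nC) mulfV ?gt_eqF.
by apply/negP => h3; have := lt_le_trans h3 h2; rewrite ltxx.
Qed.

(** The quotient [w / w'], divided by its limit, is an [n]-th root of unity tending
to [1], hence eventually equal to [1]. *)
Lemma near_root_quotient (F : set_system R) {FF : ProperFilter F} w w' z z' n :
  (0 < n)%N -> z' != 0 -> ccvg F w z -> ccvg F w' z' ->
  (\forall x \near F, w x ^+ n = w' x ^+ n) ->
  z ^+ n = z' ^+ n /\ \forall x \near F, w x = z / z' * w' x.
Proof.
move=> n0 z'0 wz wz' ww'.
have zn : z ^+ n = z' ^+ n.
  apply: (@ccvg_unique F _ (fun x => w' x ^+ n)); last exact: ccvgX.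
  by apply: ccvg_near (ccvgX n wz).
have z0 : z != 0.
  apply: contra_neq z'0 => z0; apply/eqP; move: zn.
  by rewrite z0 expr0n gtn_eqF// => /esym/eqP; rewrite expf_eq0 n0.
split=> //.
have q1 : ccvg F (fun x => w x / w' x * (z' / z)) 1.
  have -> : 1 = z / z' * (z' / z) :> C by field; rewrite z0.
  apply: ccvgM; last exact: ccvg_cst.
  by apply: ccvgM => //; exact: ccvgV.
have e0 : 0 < n%:R^-2 :> R by rewrite invr_gt0 exprn_gt0// ltr0n.
apply: filterS3 ww' (ccvg_neq0 z'0 wz') (cvg_normsq_lt e0 q1) => x wx w'0 qx.
have : w x / w' x * (z' / z) = 1.
  apply: unity_root_near1 qx => //.
  by rewrite !exprMn !exprVn wx zn divff ?expf_neq0// mul1r divff// expf_neq0.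
move=> /(congr1 (fun y => y * (z / z' * w' x))); rewrite mul1r => <-.
by field; rewrite z0 z'0 w'0.
Qed.

End ComplexCurves.

(** * Differentiation and the principal root *)

Section ComplexDifferentiation.
Variable R : realType.
Local Notation C := R[i].
Implicit Types (w f u : R -> C) (t y h : R) (z a b d : C).

Definition cdiff w t :=
  derivable (fun x => re (w x)) t 1 /\ derivable (fun x => im (w x)) t 1.

Definition cder w t : C :=
  Complex (der (fun x => re (w x)) t) (der (fun x => im (w x)) t).

Lemma cdiff_germ w w' t : (\forall s \near t, w s = w' s) -> cdiff w t -> cdiff w' t.
Proof.
move=> ww' [a b]; split.
  by apply: near_eq_derivable a; apply: filterS ww' => s ->.
by apply: near_eq_derivable b; apply: filterS ww' => s ->.
Qed.

Lemma cdiff_cst z t : cdiff (cst z) t.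
Proof. by split; exact: derivable_cst. Qed.

Lemma cdiff_real (g : R -> R) t : derivable g t 1 -> cdiff (fun s => (g s)%:C%C) t.
Proof. by move=> dg; split; [exact: dg|exact: (derivable_cst (0 : R))]. Qed.

Lemma cdiffM w w' t : cdiff w t -> cdiff w' t -> cdiff (fun s => w s * w' s) t.
Proof.
move=> [a b] [a' b']; split.
  have -> : (fun s => re (w s * w' s)) = (fun s => re (w s)) * (fun s => re (w' s)) -
      (fun s => im (w s)) * (fun s => im (w' s)) by apply/funext => s; exact: reM.
  exact: derivableB (derivableM a a') (derivableM b b').
have -> : (fun s => im (w s * w' s)) = (fun s => re (w s)) * (fun s => im (w' s)) +
    (fun s => im (w s)) * (fun s => re (w' s)) by apply/funext => s; exact: imM.
exact: derivableD (derivableM a b') (derivableM b a').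
Qed.

Lemma derivable_quotP (g : R -> R) t : derivable g t 1 <->
  exists d : R, (g (t + h) - g t) / h @[h --> 0^'] --> d.
Proof.
have E : (fun h => h^-1 *: ((g \o shift t) (h *: 1) - g t)) =
         (fun h => (g (t + h) - g t) / h).
  by apply/funext => h; rewrite /= [h%:A]mulr1 (addrC h t) [LHS]mulrC.
by rewrite /derivable E; split => [/cvg_ex|?]; [|apply/cvg_ex].
Qed.

Lemma cdiff_quotP w t : cdiff w t <->
  exists d, ccvg 0^' (fun h => (w (t + h) - w t) * (h^-1)%:C%C) d.
Proof.
have rE h : re ((w (t + h) - w t) * (h^-1)%:C%C) = (re (w (t + h)) - re (w t)) / h.
  by rewrite reM reB /= mulr0 subr0.
have iE h : im ((w (t + h) - w t) * (h^-1)%:C%C) = (im (w (t + h)) - im (w t)) / h.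
  by rewrite imM imB /= mulr0 add0r.
split=> [[/derivable_quotP[a wa] /derivable_quotP[b wb]]|[d [wr wi]]].
  exists (Complex a b); split.
    by under eq_fun do rewrite rE.
  by under eq_fun do rewrite iE.
split; apply/derivable_quotP.
  by exists (re d); under eq_fun do rewrite -rE.
by exists (im d); under eq_fun do rewrite -iE.
Qed.

Lemma cdiff_cvg w t : cdiff w t -> ccvg (nbhs t) w (w t).
Proof. by move=> [/derivable_cont a /derivable_cont b]. Qed.

Lemma cderM w w' t : cdiff w t -> cdiff w' t ->
  cder (fun s => w s * w' s) t = cder w t * w' t + w t * cder w' t.
Proof.
move=> [/derP a /derP b] [/derP a' /derP b'].
rewrite /cder; apply: complex_eq.
  rewrite /= {1}/der derive1E; under eq_fun do rewrite reM.
  have := is_deriveB (is_deriveM a a') (is_deriveM b b') => -[_ ->].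
  rewrite /GRing.scale/=.
  case: (w t) (w' t) => [? ?] [? ?]; rewrite /=; ring.
rewrite /= {1}/der derive1E; under eq_fun do rewrite imM.
have := is_deriveD (is_deriveM a b') (is_deriveM b a') => -[_ ->].
rewrite /GRing.scale/=.
by case: (w t) (w' t) => [? ?] [? ?]; rewrite /= ; ring.
Qed.

Lemma cdiffX w t n : cdiff w t -> cdiff (fun s => w s ^+ n) t.
Proof.
move=> dw; elim: n => [|n IH]; first exact: (cdiff_cst 1).
by under eq_fun do rewrite exprS; exact: cdiffM.
Qed.

Lemma cder_germ w w' t : (\forall s \near t, w s = w' s) -> cder w t = cder w' t.
Proof.
move=> ww'; rewrite /cder; congr Complex; apply: near_eq_der.
  by apply: filterS ww' => s ->.
by apply: filterS ww' => s ->.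
Qed.

Lemma cderX w t n : cdiff w t ->
  cder (fun s => w s ^+ n.+1) t = n.+1%:R * w t ^+ n * cder w t.
Proof.
move=> dw; elim: n => [|n IH].
  by under [X in cder X]eq_fun do rewrite expr1; rewrite !mul1r.
under [X in cder X]eq_fun do rewrite exprS.
rewrite (cderM dw (cdiffX n.+1 dw)) IH !exprS -(natr1 n.+1); ring.
Qed.

Lemma derivable_compose (g k : R -> R) t :
  derivable k t 1 -> derivable g (k t) 1 -> derivable (fun s => g (k s)) t 1.
Proof.
move=> /derivable1_diffP dk /derivable1_diffP dg; apply/derivable1_diffP.
exact: (differentiable_comp dk dg).
Qed.

(** The principal branch of the [n]-th root on the right half-plane, in polar
coordinates. *)
Definition croot n z : C :=
  let m := expR (ln (normsq z) / (2 * n%:R)) in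
  let x := atan (im z / re z) / n%:R in
  Complex (m * cos x) (m * sin x).

Lemma cisX (x : R) n :
  Complex (cos x) (sin x) ^+ n = Complex (cos (n%:R * x)) (sin (n%:R * x)).
Proof.
elim: n => [|n IH]; first by rewrite expr0 mul0r cos0 sin0.
rewrite exprS IH -natr1 mulrDl mul1r (addrC _ x) cosD sinD.
by apply: complex_eq; rewrite ?reM ?imM //= addrC (mulrC (sin x)) (mulrC (cos x)).
Qed.

Lemma crootK n z : (0 < n)%N -> 0 < re z -> croot n z ^+ n = z.
Proof.
move=> n0 z0; have nR : n%:R != 0 :> R by rewrite pnatr_eq0 -lt0n.
rewrite /croot /=.
set m := expR _; set x := _ / n%:R.
have -> : Complex (m * cos x) (m * sin x) = m%:C%C * Complex (cos x) (sin x).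
  by apply: complex_eq; rewrite ?reM ?imM /= ?mul0r ?subr0 ?addr0.
rewrite exprMn cisX -rmorphXn /= /x mulrC [n%:R * _]mulrC divfK//.
set v := im z / re z.
have mE : m ^+ n = expR (ln (normsq z) / 2).
  by rewrite /m -expRM_natl; congr expR; field.
have S0 : 0 < 1 + v ^+ 2 by rewrite ltr_pwDl// sqr_ge0.
have nE : normsq z = re z ^+ 2 * (1 + v ^+ 2).
  by rewrite /normsq /v; field; rewrite gt_eqF.
have N0 : 0 < normsq z by rewrite nE mulr_gt0// exprn_gt0.
have {}mE : m ^+ n = re z * Num.sqrt (1 + v ^+ 2).
  rewrite mE; apply/eqP; rewrite -(@eqrXn2 _ 2)//; last first.
    by rewrite mulr_ge0 ?sqrtr_ge0// ltW.
  rewrite exprMn sqr_sqrtr ?(ltW S0)// -nE -expRM_natl.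
  by rewrite mulrC divfK// lnK.
have cE := cos_atan v.
have c0 : cos (atan v) != 0 by rewrite cE invr_eq0 gt_eqF// sqrtr_gt0.
have sE : sin (atan v) = v * cos (atan v).
  by rewrite -[X in X * _](atanK v) /tan divfK.
have mc : m ^+ n * cos (atan v) = re z.
  by rewrite mE cE mulfK// gt_eqF// sqrtr_gt0.
apply: complex_eq; rewrite ?reM ?imM /= ?mulr0 ?subr0 ?add0r mulrC ?mc//.
by rewrite sE mulrCA mc /v divfK// gt_eqF.
Qed.

Lemma croot1 n : croot n 1 = 1.
Proof.
rewrite /croot normsq1 ln1 !mul0r expR0 atan0 mul0r cos0 sin0.
by apply: complex_eq; rewrite /= ?mulr1 ?mulr0.
Qed.

Lemma cdiff_croot n u t : 0 < re (u t) -> cdiff u t -> cdiff (fun s => croot n (u s)) t.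
Proof.
move=> u0 [dr di].
have N0 : 0 < normsq (u t) by rewrite ltr_pwDl ?exprn_gt0// sqr_ge0.
have dN : derivable (fun s => normsq (u s)) t 1.
  exact: derivableD (derivableM dr dr) (derivableM di di).
have dln : derivable (fun s => ln (normsq (u s))) t 1.
  by apply: (derivable_compose dN); have [] := is_derive1_ln N0.
have dm : derivable (fun s => expR (ln (normsq (u s)) / (2 * n%:R))) t 1.
  apply: (@derivable_compose expR); last exact: derivable_expR.
  exact: derivableM dln (derivable_cst _ _ _).
have dv : derivable (fun s => im (u s) / re (u s)) t 1.
  by apply: (derivableM di); apply: (derivableV _ dr); rewrite gt_eqF.
have dx : derivable (fun s => atan (im (u s) / re (u s)) / n%:R) t 1.
  have da : derivable (fun s => atan (im (u s) / re (u s))) t 1.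
    by apply: (@derivable_compose (@atan R) _ _ dv); exact: derivable_atan.
  exact: derivableM da (derivable_cst _ _ _).
have dc := @derivable_compose (@cos R) _ _ dx (@derivable_cos R _).
have ds := @derivable_compose (@sin R) _ _ dx (@derivable_sin R _).
by split; [exact: derivableM dm dc|exact: derivableM dm ds].
Qed.

Lemma cvg_compose (F : set_system R) {FF : Filter F} (g k : R -> R) (a : R) :
  {for a, continuous g} -> k x @[x --> F] --> a -> g (k x) @[x --> F] --> g a.
Proof. by move=> cg ka; exact: continuous_cvg. Qed.

Lemma ccvg_croot (F : set_system R) {FF : Filter F} n u :
  ccvg F u 1 -> ccvg F (fun s => croot n (u s)) 1.
Proof.
move=> u1; rewrite -(croot1 n); have cN := cvg_normsq u1; case: u1 => ur ui.
have cln : ln (normsq (u s)) @[s --> F] --> ln (normsq (1 : C)).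
  apply: (@cvg_compose F _ (@ln R) (fun s => normsq (u s)) (normsq (1 : C))).
    by apply: continuous_ln; rewrite normsq1.
  exact: cN.
have cm : expR (ln (normsq (u s)) / (2 * n%:R)) @[s --> F] -->
    expR (ln (normsq (1 : C)) / (2 * n%:R)).
  apply: (@cvg_compose _ _ expR); first exact: continuous_expR.
  exact: cvgM cln (cvg_cst _).
have cv : im (u s) / re (u s) @[s --> F] --> im (1 : C) / re (1 : C).
  have cr : (re (u s))^-1 @[s --> F] --> (re (1 : C))^-1.
    by apply: cvgV => //; exact: oner_neq0.
  exact: cvgM ui cr.
have cx : atan (im (u s) / re (u s)) / n%:R @[s --> F] -->
    atan (im (1 : C) / re (1 : C)) / n%:R.
  have ca : atan (im (u s) / re (u s)) @[s --> F] --> atan (im (1 : C) / re (1 : C)).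
    by apply: (@cvg_compose F _ (@atan R) _ _ _ cv); exact: continuous_atan.
  exact: cvgM ca (cvg_cst _).
have cc : cos (atan (im (u s) / re (u s)) / n%:R) @[s --> F] -->
    cos (atan (im (1 : C) / re (1 : C)) / n%:R).
  by apply: (@cvg_compose F _ (@cos R) _ _ _ cx); exact: continuous_cos.
have cs : sin (atan (im (u s) / re (u s)) / n%:R) @[s --> F] -->
    sin (atan (im (1 : C) / re (1 : C)) / n%:R).
  by apply: (@cvg_compose F _ (@sin R) _ _ _ cx); exact: continuous_sin.
by split; [exact: cvgM cm cc|exact: cvgM cm cs].
Qed.

End ComplexDifferentiation.

(** * Differentiable roots near zeros of exact order *)

Section RootLift.
Variable R : realType.
Local Notation C := R[i].
Variables (n : nat) (f : R -> C) (O : set R).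
Implicit Types (w : R -> C) (t y h : R) (z a b : C).

Hypothesis n_gt0 : (0 < n)%N.
Hypothesis openO : open O.
Hypothesis f_cdiff : forall t, O t -> cdiff f t.
(* Each zero of f is of order exactly n. *)
Hypothesis f_order : forall t, O t -> f t != 0 \/
  f t = 0 /\ exists2 a, a != 0 & ccvg 0^' (fun h => f (t + h) * ((h ^+ n)^-1)%:C%C) a.

Definition is_root w t := cdiff w t /\ w t ^+ n = f t.

Lemma complex_root_exists a : exists b, b ^+ n = a.
Proof. by exists (n.-root a); rewrite rootCK. Qed.

Lemma ccvg_re_gt0 (F : set_system R) {FF : Filter F} w :
  ccvg F w 1 -> \forall x \near F, 0 < re (w x).
Proof. by move=> [wr _]; apply: (cvgr_gt (1 : R) wr). Qed.

(** Near a point where [f] is not zero take a branch of the [n]-th root. At a zero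
[y] of order exactly [n], take [t - y] times a branch of the root of
[f t / (t - y)^n], which extends continuously to [y] with a nonzero value; this
value is the derivative at [y]. *)
Lemma root_lift_local y : O y -> exists w, \forall t \near y, is_root w t.
Proof.
move=> Oy; have [fy|[fy [a a0 fa]]] := f_order Oy.
  have [b bE] := complex_root_exists (f y).
  exists (fun t => b * croot n (f t * (f y)^-1)).
  have u1 : ccvg (nbhs y) (fun t => f t * (f y)^-1) 1.
    rewrite -(divff fy); apply: ccvgM; last exact: ccvg_cst.
    exact/cdiff_cvg/f_cdiff.
  have On : \forall t \near y, O t by exact: open_nbhs_nbhs.
  apply: filterS2 On (ccvg_re_gt0 u1) => t Ot ut; split.
    apply: cdiffM; first exact: cdiff_cst.
    apply: cdiff_croot => //; apply: cdiffM; [exact: f_cdiff|exact: cdiff_cst].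
  by rewrite exprMn crootK// bE mulrCA divff// mulr1.
have [b bE] := complex_root_exists a.
pose u t := f t * (((t - y) ^+ n)^-1)%:C%C * a^-1.
pose w t := (t - y)%:C%C * (b * croot n (u t)).
exists w.
have u1 : ccvg 0^' (fun h => u (y + h)) 1.
  rewrite -(divff a0) /u; apply: ccvgM; last exact: ccvg_cst.
  by apply: ccvg_near fa; near=> h; rewrite [y + h]addrC addrK.
have wy : w y = 0 by rewrite /w subrr mul0r.
apply: dnbhs0_near; last first.
  split; last by rewrite wy fy expr0n gtn_eqF.
  apply/cdiff_quotP; exists (b * 1).
  have bu : ccvg 0^' (fun h => b * croot n (u (y + h))) (b * 1).
    by apply: ccvgM; [exact: ccvg_cst|exact: ccvg_croot].
  apply: ccvg_near bu.
  apply/dnearP; exists 1 => // h h0 _.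
  rewrite wy subr0 /w (addrC y h) addrK.
  rewrite mulrAC -rmorphM/= divff// mul1r//.
have On : \forall h \near 0^', O (y + h).
  by apply: near_dnbhs0; exact: open_nbhs_nbhs.
have nz : \forall h \near (0 : R)^', h != 0 by apply/dnearP; exists 1.
apply: filterS3 nz On (ccvg_re_gt0 u1) => h h0 Oh uh.
have yh : y + h - y = h by rewrite addrC addKr.
split.
  have dty (s : R) : derivable (fun t : R => t - y) s 1.
    by apply: (@derivableB _ _ _ id (cst y)).
  apply: cdiffM; first exact: cdiff_real.
  apply: cdiffM; first exact: cdiff_cst.
  apply: cdiff_croot => //; apply: cdiffM; last exact: cdiff_cst.
  apply: cdiffM; first exact: f_cdiff.
  apply: (@cdiff_real _ (fun t => ((t - y) ^+ n)^-1)).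
  apply: derivableV; first by rewrite yh expf_neq0.
  have -> : (fun t : R => (t - y) ^+ n) = (fun t : R => t - y) ^+ n.
    by apply/funext => t; rewrite exprfctE.
  exact: derivableX.
rewrite !exprMn bE crootK// /u yh.
rewrite mulrCA [a * _]mulrC -!mulrA mulVf// mulr1 mulrCA -rmorphXn -rmorphM /=.
by rewrite divff ?expf_neq0// mulr1.
Unshelve. all: by end_near.
Qed.

Lemma root_lift_zero w t : is_root w t -> f t = 0 -> w t = 0.
Proof. by move=> [_ wf] ft; move: wf; rewrite ft => /eqP; rewrite expf_eq0 n_gt0 => /eqP. Qed.

(** At a zero [y] of [f] the quotients [w (y + h) / h] and [w' (y + h) / h] tend to
[n]-th roots of the nonzero limit of [f (y + h) / h^n], so [near_root_quotient]
applies to them. *)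
Lemma root_lift_trans y w w' : O y ->
  (\forall t \near y, is_root w t) -> (\forall t \near y, is_root w' t) ->
  exists2 z, z ^+ n = 1 & \forall t \near y, w t = z * w' t.
Proof.
move=> Oy wP wP'.
have [dw wf] := nbhs_singleton wP; have [dw' wf'] := nbhs_singleton wP'.
have near_pow : \forall t \near y, w t ^+ n = w' t ^+ n.
  by apply: filterS2 wP wP' => t [_ ->] [_ ->].
have unit_pow z z' : z' != 0 -> z ^+ n = z' ^+ n -> (z / z') ^+ n = 1.
  by move=> z0 zE; rewrite exprMn exprVn zE divff// expf_neq0.
have [fy|[fy [a a0 fa]]] := f_order Oy.
  have w'0 : w' y != 0.
    by apply: contra_neq fy => w'0; rewrite -wf' w'0 expr0n gtn_eqF.
  have [E ww'] := near_root_quotient n_gt0 w'0 (cdiff_cvg dw) (cdiff_cvg dw') near_pow.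
  by exists (w y / w' y) => //; exact: unit_pow.
have wy := root_lift_zero (conj dw wf) fy.
have wy' := root_lift_zero (conj dw' wf') fy.
have /cdiff_quotP[d wd] := dw; have /cdiff_quotP[d' wd'] := dw'.
have powd v c : v y = 0 -> (\forall t \near y, is_root v t) ->
    ccvg 0^' (fun h => (v (y + h) - v y) * (h^-1)%:C%C) c -> c ^+ n = a.
  move=> vy vP vc; apply: (@ccvg_unique _ 0^' _ _ _ _ _ fa).
  apply: ccvg_near (ccvgX n vc); apply: filterS (near_dnbhs0 vP) => h [_ vf].
  by rewrite vy subr0 exprMn vf -rmorphXn /= exprVn.
have d'0 : d' != 0.
  by apply: contra_neq a0 => d'0; rewrite -(powd _ _ wy' wP' wd') d'0 expr0n gtn_eqF.
have pows : \forall h \near 0^', ((w (y + h) - w y) * (h^-1)%:C%C) ^+ n =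
    ((w' (y + h) - w' y) * (h^-1)%:C%C) ^+ n.
  by apply: filterS (near_dnbhs0 near_pow) => h E; rewrite wy wy' !subr0 !exprMn E.
have [E ww'] := near_root_quotient n_gt0 d'0 wd wd' pows.
exists (d / d'); first exact: unit_pow.
apply: dnbhs0_near; last by rewrite wy wy' mulr0.
have nz : \forall h \near (0 : R)^', h != 0 by apply/dnearP; exists 1.
apply: filterS2 nz ww' => h h0; rewrite wy wy' !subr0 mulrA => /mulIf; apply.
by rewrite -(rmorph0 (real_complex R)) (inj_eq (@complexI R)) invr_eq0.
Qed.

Lemma f_isolated_zero y : O y -> \forall t \near y, t != y -> f t != 0.
Proof.
move=> Oy; have [fy|[fy [a a0 fa]]] := f_order Oy.
  by apply: filterS (ccvg_neq0 fy (cdiff_cvg (f_cdiff Oy))) => t ft _.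
apply: dnbhs0_near; last by rewrite eqxx.
by apply: filterS (ccvg_neq0 a0 fa) => h; rewrite mulf_eq0 negb_or => /andP[].
Qed.

(** The two roots differ by a constant factor near [y], and zeros of [f] are
isolated, so a point near [y] at which both agree and do not vanish shows
that the factor is [1]. *)
Lemma root_lift_rigid y w w' : O y ->
  (\forall t \near y, is_root w t) -> (\forall t \near y, is_root w' t) ->
  closure [set s : R | \forall u \near s, w u = w' u] y ->
  \forall t \near y, w t = w' t.
Proof.
move=> Oy wP wP' cl; have [z _ wz] := root_lift_trans Oy wP wP'.
have [s [ws]] := cl _ (filterI (filterI wz wP') (f_isolated_zero Oy)).
move=> [[wzs [_ w's]] fs]; have [<-//|sy] := eqVneq s y.
have w's0 : w' s != 0.
  by apply: contra_neq (fs sy) => w's0; rewrite -w's w's0 expr0n gtn_eqF.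
have z1 : z = 1.
  by apply/(mulIf w's0); rewrite mul1r -wzs; exact: nbhs_singleton ws.
by apply: filterS wz => t ->; rewrite z1 mul1r.
Qed.

Lemma root_lift : exists w, forall t, O t -> is_root w t.
Proof.
apply: (@monodromy R C 0 O is_root [set g | exists2 z, z ^+ n = 1 & g = *%R z]).
- exact: openO.
- move=> w w' t ww' [dw wf]; split; first exact: cdiff_germ dw.
  by rewrite -(nbhs_singleton ww').
- move=> _ w t [z zn ->] [dw wf]; split; last by rewrite /= exprMn zn mul1r.
  by apply: cdiffM => //; exact: cdiff_cst.
- exact: root_lift_local.
- move=> t w w' Ot wP wP'; have [z zn wz] := root_lift_trans Ot wP wP'.
  by exists ( *%R z) => //; exists z.
- exact: root_lift_rigid.
Qed.

End RootLift.

(** * Differentiable roots with bounded derivative *)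

Section RootCurve.
Variable R : realType.
Local Notation C := R[i].
Implicit Types (f w : R -> C) (r g : R -> R) (I J : set R) (t h : R).

Lemma der_cvg g t : derivable g t 1 -> (g (t + h) - g t) / h @[h --> 0^'] --> der g t.
Proof.
move=> dg; have : h^-1 *: ((g \o shift t) (h *: 1) - g t) @[h --> 0^'] --> der g t.
  by rewrite /der derive1E; exact: dg.
apply: cvg_trans; apply: near_eq_cvg; apply/dnearP; exists 1 => // h _ _.
by rewrite /= [h%:A]mulr1 (addrC h t) [RHS]mulrC.
Qed.

(** As [r (t + h) = O(h^2)] at a zero of [r], one has [g (t + h) = O(h^(k+2))]. *)
Lemma root_quotient_cvg k I r g t : open I -> I t -> Ck k.+2 I r -> Ck k.+2 I g ->
  (forall s, I s -> 0 <= r s) -> (forall s, I s -> g s ^+ 2 <= r s ^+ k.+2) ->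
  r t = 0 -> exists L : R, g (t + h) / h ^+ k.+2 @[h --> 0^'] --> L.
Proof.
move=> oI It Cr Cg r0 gr rt0.
have [M M0 [e e0 eM]] := zero_quadratic oI It (Ck_leq (leq_addr k 2) Cr) r0.
apply: (power_quotient_cvg oI It Cg); exists (Num.sqrt M ^+ k.+2).
have Ih : \forall h \near 0^', I (t + h).
  by apply: near_dnbhs0; exact: open_nbhs_nbhs.
have he : \forall h \near (0 : R)^', `|h| < e.
  by apply/dnearP; exists e => // h _.
apply: filterS2 Ih he => h Ih he.
have B0 : 0 <= Num.sqrt M ^+ k.+2 * `|h| ^+ k.+2.
  by apply: mulr_ge0; rewrite exprn_ge0// sqrtr_ge0.
have gle : `|g (t + h)| ^+ 2 <= (Num.sqrt M ^+ k.+2 * `|h| ^+ k.+2) ^+ 2.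
  rewrite real_normK ?num_real//; apply: le_trans (gr _ Ih) _.
  rewrite -exprMn -exprM mulnC exprM; apply: lerXn2r.
  - by rewrite nnegrE r0.
  - by rewrite nnegrE exprn_ge0// mulr_ge0 ?sqrtr_ge0.
  rewrite exprMn sqr_sqrtr// real_normK ?num_real//.
  by apply: eM => //; rewrite subrr normr0.
by move: gle; rewrite ler_pXn2r ?nnegrE.
Qed.

Lemma cvg_sqr_le0 (F : set_system R) {FF : Filter F} (g q : R -> R) :
  (\forall x \near F, g x ^+ 2 <= q x) -> q x @[x --> F] --> (0 : R) ->
  g x @[x --> F] --> (0 : R).
Proof.
move=> gq q0; apply/cvgr0Pnorm_lt => e e0.
have e20 : 0 < e ^+ 2 by rewrite exprn_gt0.
apply: filterS2 gq (cvgr_lt (0 : R) q0 _ e20) => x gx qx.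
rewrite -ltr_sqr ?nnegrE ?(ltW e0)// real_normK ?num_real//.
exact: le_lt_trans gx qx.
Qed.

Section Lift.
Variables (k : nat) (I : set R) (r : R -> R) (f : R -> C).
Local Notation n := k.+2.
Hypothesis openI : open I.
Hypothesis r_smooth : Ck n I r.
Hypothesis f_smooth : Ck n I (fun t => re (f t)) /\ Ck n I (fun t => im (f t)).
Hypothesis r_ge0 : forall t, I t -> 0 <= r t.
Hypothesis rf : forall t, I t -> normsq (f t) = r t ^+ n.

(** The complement in [I] of the zeros of [r] of order higher than two. *)
Definition regular : set R := [set t | I t /\
  (r t != 0 \/ r t = 0 /\ exists2 l : R, l != 0 & r (t + h) / h ^+ 2 @[h --> 0^'] --> l)].

Lemma re_sqr_le t : I t -> re (f t) ^+ 2 <= r t ^+ n.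
Proof. by move=> It; rewrite -rf// lerDl sqr_ge0. Qed.

Lemma im_sqr_le t : I t -> im (f t) ^+ 2 <= r t ^+ n.
Proof. by move=> It; rewrite -rf// lerDr sqr_ge0. Qed.

Lemma f_eq0 t : I t -> (f t == 0) = (r t == 0).
Proof. by move=> It; rewrite -normsq_eq0 rf// expf_eq0. Qed.

Lemma f_diff t : I t -> cdiff f t.
Proof. by move=> It; case: f_smooth => -[dr _] [di _]; split; [exact: dr|exact: di]. Qed.

Lemma regular_open : open regular.
Proof.
rewrite openE => t [It rt].
have In : \forall s \near t, I s by exact: open_nbhs_nbhs.
have cr := Ck_continuous r_smooth It.
have [rt0|rt0] := eqVneq (r t) 0; last first.
  have : \forall s \near t, r s != 0.
    have r0 : 0 < r t by rewrite lt0r rt0 r_ge0.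
    by apply: filterS (cvgr_gt (r t) cr _ r0) => s rs; rewrite gt_eqF.
  by apply: filterS2 In => s Is rs; split=> //; left.
have [l l0 rl] : exists2 l : R, l != 0 & r (t + h) / h ^+ 2 @[h --> 0^'] --> l.
  by case: rt => [|[_ //]]; rewrite rt0 eqxx.
apply: dnbhs0_near; last by split=> //; right; split=> //; exists l.
have nz : \forall h \near 0^', r (t + h) / h ^+ 2 != 0 by exact: (cvgr_neq0 l rl l0).
apply: filterS2 (near_dnbhs0 In) nz => h Ih; rewrite mulf_eq0 negb_or => /andP[rh _].
by split=> //; left.
Qed.

(** The limit of [f / h^n] is nonzero because its square modulus is the [n]-th power
of the limit of [r / h^2]. *)
Lemma f_order t : regular t -> f t != 0 \/
  f t = 0 /\ exists2 a, a != 0 & ccvg 0^' (fun h => f (t + h) * ((h ^+ n)^-1)%:C%C) a.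
Proof.
move=> [It rt]; have [rt0|rt0] := eqVneq (r t) 0; last by left; rewrite f_eq0.
right; split; first by apply/eqP; rewrite f_eq0// rt0.
have [l l0 rl] : exists2 l : R, l != 0 & r (t + h) / h ^+ 2 @[h --> 0^'] --> l.
  by case: rt => [|[_ //]]; rewrite rt0 eqxx.
have [a ra] := root_quotient_cvg openI It r_smooth f_smooth.1 r_ge0 re_sqr_le rt0.
have [b rb] := root_quotient_cvg openI It r_smooth f_smooth.2 r_ge0 im_sqr_le rt0.
have fab : ccvg 0^' (fun h => f (t + h) * ((h ^+ n)^-1)%:C%C) (Complex a b).
  split.
    by under eq_fun do rewrite reM /= mulr0 subr0.
  by under eq_fun do rewrite imM /= mulr0 add0r.
exists (Complex a b) => //; rewrite -normsq_eq0.
have c1 : normsq (f (t + h) * ((h ^+ n)^-1)%:C%C) @[h --> 0^'] --> normsq (Complex a b).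
  exact: cvg_normsq fab.
have c2 : (r (t + h) / h ^+ 2) ^+ n @[h --> 0^'] --> l ^+ n.
  by apply: (@cvg_compose _ _ _ (fun x : R => x ^+ n)) rl; exact: exprn_continuous.
have c3 : normsq (f (t + h) * ((h ^+ n)^-1)%:C%C) @[h --> 0^'] --> l ^+ n.
  apply: cvg_trans c2; apply: near_eq_cvg.
  have In : \forall s \near t, I s by exact: open_nbhs_nbhs.
  apply: filterS (near_dnbhs0 In) => h Ih.
  rewrite normsqM rf// /normsq /= expr0n addr0 expr_div_n; congr (_ * _).
  by rewrite exprVn -!exprM mulnC.
by rewrite (cvg_unique _ c1 c3)// expf_neq0.
Qed.

(** Extend by [0] the root of [root_lift] on the regular set. *)
Lemma root_curve_order_ge2 t0 : I t0 -> exists J w (M : R), [/\ open J, J t0, J `<=` I &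
  forall t, J t -> [/\ cdiff w t, w t ^+ n = f t & normsq (cder w t) <= M]].
Proof.
move=> It0.
have [w0 w0P] : exists w, forall t, regular t -> is_root n f w t.
  by apply: root_lift => //; [exact: regular_open|move=> t [/f_diff]|exact: f_order].
pose w t := if t \in regular then w0 t else 0.
have wE t : regular t -> w t = w0 t by move=> rt; rewrite /w mem_set.
have r0 t : I t -> ~ regular t -> r t = 0.
  by move=> It; apply: contra_notP => /eqP rt; split=> //; left.
have wn t : I t -> w t ^+ n = f t.
  move=> It; have [rt|nrt] := pselect (regular t).
    by rewrite wE//; have [] := w0P _ rt.
  rewrite /w memNset// expr0n/=; apply/esym/eqP.
  by rewrite f_eq0// r0.
have wr t : I t -> normsq (w t) = r t.
  move=> It; apply/eqP; rewrite -(@eqrXn2 _ n)// ?normsq_ge0 ?r_ge0//.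
  by rewrite -normsqX wn// rf.
have Inear t : I t -> \forall s \near t, I s by move=> It; exact: open_nbhs_nbhs.
have dw t : I t -> cdiff w t.
  move=> It; have [rt|nrt] := pselect (regular t).
    have [dw0 _] := w0P _ rt; apply: cdiff_germ dw0.
    by apply: (open_near regular_open rt) => s rs; rewrite wE.
  (* Here |w (t + h)|^2 = r (t + h) = o(h^2), so the derivative of w is 0. *)
  have rt := r0 _ It nrt.
  have rI2 s : I s -> r s ^+ 2 <= r s ^+ 2 by [].
  have [l rl] := @root_quotient_cvg 0 I r r t openI It
    (Ck_leq (leq_addr k 2) r_smooth) (Ck_leq (leq_addr k 2) r_smooth) r_ge0 rI2 rt.
  have l0 : l = 0.
    apply: contra_notP nrt => /eqP l0; split=> //; right; split=> //.
    by exists l.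
  rewrite l0 in rl.
  have wt : w t = 0 by rewrite /w memNset.
  have q h : I (t + h) -> normsq ((w (t + h) - w t) * (h^-1)%:C%C) = r (t + h) / h ^+ 2.
    move=> Ih; rewrite wt subr0 normsqM wr// /normsq /= expr0n addr0.
    by rewrite exprVn.
  apply/cdiff_quotP; exists 0; split; apply: (cvg_sqr_le0 _ rl).
    apply: filterS (near_dnbhs0 (Inear _ It)) => h /q <-.
    by rewrite lerDl sqr_ge0.
  apply: filterS (near_dnbhs0 (Inear _ It)) => h /q <-.
  by rewrite lerDr sqr_ge0.
have [C1 C10 B1] := root_bound openI It0 r_smooth f_smooth.1 r_ge0 re_sqr_le.
have [C2 C20 B2] := root_bound openI It0 r_smooth f_smooth.2 r_ge0 im_sqr_le.
have [M M0 [e e0 eM]] := zero_quadratic openI It0 (Ck_leq (leq_addr k 2) r_smooth) r_ge0.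
have /nearP[d d0 dP] : \forall t \near t0,
    [/\ 0 < r t -> `|der (fun s => re (f s)) t| <= C1 * Num.sqrt (r t) ^+ k.+1,
        0 < r t -> `|der (fun s => im (f s)) t| <= C2 * Num.sqrt (r t) ^+ k.+1 & I t].
  by apply: filterS3 B1 B2 (Inear _ It0) => t.
pose c := Num.min d e.
have c0 : 0 < c by rewrite lt_min d0.
exists (ball t0 c), w, (C1 ^+ 2 + C2 ^+ 2 + M); split.
- exact: ball_open.
- exact: ballxx.
- move=> t; rewrite /ball/= distrC lt_min => /andP[td _].
  by have [] := dP _ td.
move=> t; rewrite /ball/= distrC lt_min => /andP[td te].
have [B1t B2t It] := dP _ td; split; [exact: dw|exact: wn|].
have A0 : 0 <= C1 ^+ 2 + C2 ^+ 2 by rewrite addr_ge0// sqr_ge0.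
have [dwr dwi] := dw _ It.
have [rt|rt] := eqVneq (r t) 0.
  (* The quotients w (t + h) / h are bounded by the square root of M. *)
  apply: (@le_trans _ _ M); last by rewrite lerDr.
  have wt : w t = 0 by apply/eqP; rewrite -normsq_eq0 wr// rt.
  have ca := der_cvg dwr; have cb := der_cvg dwi; rewrite wt /= in ca cb.
  have cn : ((re (w (t + h)) - 0) / h) ^+ 2 + ((im (w (t + h)) - 0) / h) ^+ 2
      @[h --> 0^'] --> normsq (cder w t).
    exact: cvgD (cvgM ca ca) (cvgM cb cb).
  apply: (ler_cvg_to cn (cvg_cst M)).
  have he : \forall h \near (0 : R)^', h != 0 /\ `|h| < e by apply/dnearP; exists e.
  apply: filterS2 he (near_dnbhs0 (Inear _ It)) => h [h0 he] Ih.
  rewrite !subr0 !expr_div_n -mulrDl ler_pdivrMr ?exprn_even_gt0//.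
  by have := eM t h te he rt; rewrite -wr.
have rt0 : 0 < r t by rewrite lt0r rt r_ge0.
(* Differentiate w^n = f and cancel the common factor r^(k+1) = |w^(k+1)|^2. *)
have Ed : cder f t = n%:R * w t ^+ k.+1 * cder w t.
  rewrite -(cderX k.+1 (dw _ It)); apply: cder_germ.
  by apply: (open_near openI It) => s Is; rewrite wn.
have sqr_le (x b : R) : 0 <= b -> `|x| <= b * Num.sqrt (r t) ^+ k.+1 ->
    x ^+ 2 <= b ^+ 2 * r t ^+ k.+1.
  move=> b0 xb; rewrite -(sqr_sqrtr (ltW rt0)) -exprM mulnC exprM -exprMn.
  rewrite -real_normK ?num_real//; apply: lerXn2r => //.
  by rewrite nnegrE mulr_ge0// exprn_ge0// sqrtr_ge0.
have : normsq (cder f t) <= (C1 ^+ 2 + C2 ^+ 2) * r t ^+ k.+1.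
  by rewrite mulrDl; apply: lerD; apply: sqr_le => //; [exact: B1t|exact: B2t].
rewrite Ed !normsqM normsqX wr// mulrAC ler_pM2r ?exprn_gt0// => le_n.
apply: (@le_trans _ _ (C1 ^+ 2 + C2 ^+ 2)); last by rewrite lerDl.
apply: le_trans le_n; rewrite ler_peMl ?normsq_ge0//.
have -> : n%:R = (n%:R : R)%:C%C :> C by rewrite rmorph_nat.
by rewrite /normsq /= expr0n addr0 exprn_ege1// ler1n.
Qed.

End Lift.
End RootCurve.

(** * Rotations, invariant polynomials and smooth curves *)

Section RotationRoots.
Variable R : realType.
Local Notation C := R[i].

Definition cplx (x : 'cV[R]_2) : C := Complex (x 0 0) (x 1 0).

Lemma cplx_inj : injective cplx.
Proof.
move=> x y [h0 h1]; apply/matrixP => i j; rewrite ord1.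
have [->|->] : i = 0 \/ i = 1; last by [].
  by case: i => [[|[|i]]] // hi; [left|right]; exact/val_inj.
by [].
Qed.

Lemma cplx_rot2 (a : R) x : cplx (rot2 a *m x) = Complex (cos a) (sin a) * cplx x.
Proof. by apply: complex_eq; rewrite ?reM ?imM /= mulmx2E !mxE/=; ring. Qed.

Lemma cplx_rot2X (a : R) k x :
  cplx (rot2 a ^+ k *m x) = Complex (cos a) (sin a) ^+ k * cplx x.
Proof. by rewrite rot2X cplx_rot2 cisX mulr_natl. Qed.

(** As [cos a = 1], the double angle formula gives [sin (a / 2) = 0], which is
impossible for [0 < a / 2 < pi]. *)
Lemma cis_eq1 (a : R) : Complex (cos a) (sin a) = 1 -> 0 < a -> 2 * pi <= a.
Proof.
move=> [ca _] a0; rewrite leNgt; apply/negP => a2.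
have : 0 < sin (a / 2) by apply: sin_gt0_pi; apply/andP; split; lra.
have aE : a / 2 *+ 2 = a by rewrite -mulr_natr divfK.
have := cos_mulr2n (a / 2); rewrite aE ca cos2sin2 => h1 h2.
have : sin (a / 2) ^+ 2 = 0 by lra.
by move/eqP; rewrite sqrf_eq0 gt_eqF.
Qed.

Lemma cis_primitive n : (0 < n)%N ->
  n.-primitive_root (Complex (cos (2 * pi / n%:R)) (sin (2 * pi / n%:R)) : C).
Proof.
move=> n0; have nR : 0 < n%:R :> R by rewrite ltr0n.
rewrite /primitive_root_of_unity n0 /=; apply/forallP => i; apply/eqP.
rewrite unity_rootE cisX; apply/eqP/eqP => [|->]; last first.
  rewrite mulrC divfK ?gt_eqF// mulr_natl cos2pi sin2pi.
  by apply: complex_eq.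
move=> /cis_eq1; have p0 := pi_gt0 R.
rewrite mulr_gt0 ?ltr0n// ?divr_gt0 ?mulr_gt0// => /(_ isT).
rewrite mulrA ler_pdivlMr// mulrC ler_pM2r ?mulr_gt0// ler_nat => ni.
by apply/eqP; rewrite eqn_leq ni ltn_ord.
Qed.

Lemma rot2_root n g : (0 < n)%N -> C2_set n g ->
  exists2 z : C, z ^+ n = 1 & forall x, cplx (g *m x) = z * cplx x.
Proof.
move=> n0 [k ->]; set c : C := Complex (cos (2 * pi / n%:R)) (sin (2 * pi / n%:R)).
exists (c ^+ k) => [|x]; last exact: cplx_rot2X.
by rewrite exprAC (prim_expr_order (cis_primitive n0)) expr1n.
Qed.

(** The powers of [cis (2 * pi / n)] are all the [n]-th roots of unity, as it is a
primitive one. *)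
Lemma root_rot2 n (x y : 'cV[R]_2) : (0 < n)%N -> cplx x ^+ n = cplx y ^+ n ->
  exists2 g, C2_set n g & x = g *m y.
Proof.
move=> n0 xy; have [y0|y0] := eqVneq (cplx y) 0.
  exists 1%:M; first exact: C2_one.
  rewrite mul1mx; apply: cplx_inj; rewrite y0.
  have : cplx x ^+ n == 0 by rewrite xy y0 expr0n gtn_eqF.
  by rewrite expf_eq0 n0 => /eqP.
have : (cplx x / cplx y) ^+ n = 1 by rewrite expr_div_n xy divff// expf_neq0.
move=> /(prim_rootP (cis_primitive n0))[k kE].
exists (rot2 (2 * pi / n%:R) ^+ k); first by exists k.
by apply: cplx_inj; rewrite cplx_rot2X -kE divfK.
Qed.

End RotationRoots.

Section PolynomialFunctions.
Variables (R : realType) (d : nat).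
Implicit Types (F : 'cV[R]_d -> R).

Definition polyfun F := exists p, forall v, peval v p = F v.

Lemma polyfun_cst (a : R) : polyfun (fun=> a).
Proof. by exists (mpoly.mpolyC _ a) => v; rewrite /peval mpoly.mevalC. Qed.

Lemma polyfun_coord i : polyfun (fun v => v i 0).
Proof. by exists (mpoly.mpolyX _ (mpoly.mnm1 i)) => v; rewrite /peval mpoly.mevalXU. Qed.

Lemma polyfunD F F' : polyfun F -> polyfun F' -> polyfun (fun v => F v + F' v).
Proof.
by move=> [p pF] [q qF]; exists (p + q) => v; rewrite /peval mpoly.mevalD -pF -qF.
Qed.

Lemma polyfunM F F' : polyfun F -> polyfun F' -> polyfun (fun v => F v * F' v).
Proof.
by move=> [p pF] [q qF]; exists (p * q) => v; rewrite /peval mpoly.mevalM -pF -qF.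
Qed.

Lemma polyfun_eq F F' : F =1 F' -> polyfun F -> polyfun F'.
Proof. by move=> FF' [p pF]; exists p => v; rewrite pF. Qed.

Lemma polyfun_sum (I : Type) (s : seq I) (F : I -> 'cV[R]_d -> R) :
  (forall i, polyfun (F i)) -> polyfun (fun v => \sum_(i <- s) F i v).
Proof.
move=> pF; elim: s => [|i s IH].
  by apply: polyfun_eq (polyfun_cst 0) => v; rewrite big_nil.
by apply: polyfun_eq (polyfunD (pF i) IH) => v; rewrite big_cons.
Qed.

Lemma polyfun_mx k (A : 'M[R]_(k, d)) i : polyfun (fun v => (A *m v) i 0).
Proof.
apply: (@polyfun_eq (fun v => \sum_j A i j * v j 0)).
  by move=> v; rewrite mxE.
apply: polyfun_sum => j; apply: polyfunM; [exact: polyfun_cst|exact: polyfun_coord].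
Qed.

Lemma polyfun_cplxX (A : 'M[R]_(2, d)) n :
  polyfun (fun v => re (cplx (A *m v) ^+ n)) /\ polyfun (fun v => im (cplx (A *m v) ^+ n)).
Proof.
have pN F : polyfun F -> polyfun (fun v => - F v).
  by move=> /(polyfunM (polyfun_cst (-1))); apply: polyfun_eq => v; rewrite mulN1r.
elim: n => [|n [IHr IHi]]; first by split; exact: polyfun_cst.
have pA i := polyfun_mx A i; split.
  have := polyfunD (polyfunM (pA 0) IHr) (pN _ (polyfunM (pA 1) IHi)).
  by apply: polyfun_eq => v; rewrite exprS reM.
have := polyfunD (polyfunM (pA 0) IHi) (polyfunM (pA 1) IHr).
by apply: polyfun_eq => v; rewrite exprS imM.
Qed.

(** Evaluating at [v] a polynomial in the generators is evaluating it at the orbit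
map. *)
Lemma invariant_factor (G : finOrthGroup R d) m (s : m.-tuple (mpoly.mpoly d R)) F :
  hom_generators G s -> polyfun F -> (forall A v, og_set G A -> F (A *m v) = F v) ->
  exists q, forall v, peval (orbit_map s v) q = F v.
Proof.
move=> gs [p pF] FG; have [A v GA|q pq] := @hg_gen _ _ _ _ _ gs p.
  by rewrite !pF FG.
exists q => v; rewrite -pF pq /peval mpoly.comp_mpoly_meval.
by apply: mpoly.meval_eq => i; rewrite mxE.
Qed.

End PolynomialFunctions.

Section CoordinateCurves.
Variables (R : realType) (m : nat).
Implicit Types (c : R -> 'cV[R]_m) (I : set R).

Lemma Ck_coord k I c i : open I -> Ck_on k I c -> Ck k I (fun t => c t i 0).
Proof.
move=> oI; elim: k c => [|k IH] c [dc cc].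
  move=> t It; have ct : {for t, continuous c} := cc t It.
  by apply: (@continuous_comp _ _ _ c (fun M : 'cV[R]_m => M i 0)) ct _; exact: coord_continuous.
have dct t : I t -> derivable c t 1 by move=> It; exact: (dc 0%N t _ It).
split=> [t It|]; first exact: ((derivable_mxP c t 1).1 (dct t It) i 0).
have : Ck_on k I (derive1 c).
  split=> [j t jk It|t It]; first by rewrite -derive1Sn; exact: dc.
  by rewrite -derive1Sn; exact: cc.
move=> /IH; apply: Ck_eq => // t It.
by rewrite /der !derive1E derive_mx ?mxE//; exact: dct.
Qed.

Lemma Ck_peval k I c q : open I -> Ck_on k I c -> Ck k I (fun t => peval (c t) q).
Proof.
move=> oI Cc; apply: Ck_sum => // mon; apply: Ck_mul => //; first exact: Ck_cst.
apply: Ck_prod => // i; apply: Ck_exp => //; exact: Ck_coord.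
Qed.

End CoordinateCurves.

(** * Lifting over rotation groups *)

Section PropertyB.
Variable R : realType.
Local Notation C := R[i].

Lemma root_curve n (I : set R) (r : R -> R) (f : R -> C) t0 :
  (0 < n)%N -> open I -> I t0 -> Ck n I r ->
  Ck n I (fun t => re (f t)) -> Ck n I (fun t => im (f t)) ->
  (forall t, I t -> 0 <= r t) -> (forall t, I t -> normsq (f t) = r t ^+ n) ->
  exists J w (M : R), [/\ open J, J t0, J `<=` I &
  forall t, J t -> [/\ cdiff w t, w t ^+ n = f t & normsq (cder w t) <= M]].
Proof.
case: n => [//|[|k]] _ oI It0 Cr Cfr Cfi r0 rf; last first.
  exact: (root_curve_order_ge2 oI Cr (conj Cfr Cfi) r0 rf It0).
(* For n = 1, f is its own root. *)
have [A A0 cA] := continuous_near_bounded (Cfr.2 t0 It0).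
have [B B0 cB] := continuous_near_bounded (Cfi.2 t0 It0).
have In : \forall t \near t0, I t by exact: open_nbhs_nbhs.
have /nearP[e e0 eP] : \forall t \near t0, [/\ I t,
    `|der (fun t => re (f t)) t| <= A & `|der (fun t => im (f t)) t| <= B].
  by apply: filterS3 In cA cB => t.
have {}eP t : ball t0 e t -> [/\ I t,
    `|der (fun t => re (f t)) t| <= A & `|der (fun t => im (f t)) t| <= B].
  by rewrite /ball/= distrC => /eP.
exists (ball t0 e), f, (A ^+ 2 + B ^+ 2); split.
- exact: ball_open.
- exact: ballxx.
- by move=> t /eP[].
move=> t /eP[It At Bt]; split=> //; first by split; [exact: Cfr.1|exact: Cfi.1].
have sqr_le (x b : R) : `|x| <= b -> x ^+ 2 <= b ^+ 2.
  by move=> xb; rewrite -real_normK ?num_real//; apply: lerXn2r => //; rewrite nnegrE (le_trans _ xb).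
by apply: lerD; exact: sqr_le.
Qed.

Lemma normsq_isometry (g : 'M[R]_2) (x : 'cV[R]_2) n : (0 < n)%N -> C2_set n g ->
  normsq (cplx (g *m x)) = normsq (cplx x).
Proof.
move=> n0 /(rot2_root n0)[z zn ->]; rewrite normsqM.
have /eqP : normsq z ^+ n = 1 by rewrite -normsqX zn normsq1.
by rewrite pexpr_eq1 ?normsq_ge0// => /eqP ->; rewrite mul1r.
Qed.

Lemma mx_col2 p (B : 'M[R]_(p, 2)) (x : 'cV[R]_2) i :
  (B *m x) i 0 = B i 0 * re (cplx x) + B i 1 * im (cplx x).
Proof. exact: mulmx2E. Qed.

(** Both groups of the theorem are of this form: [B] is a linear isometry of the
plane onto the rotation plane and [1 - B B^T] is the projection onto its
orthogonal complement. A lift is [B w + h] with [w] from [root_curve] and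
[h] the component of the curve in the orthogonal complement. *)
Lemma extended_rotation_property_B n d (B : 'M[R]_(d, 2)) (G : finOrthGroup R d) :
  (0 < n)%N -> B^T *m B = 1%:M ->
  (forall A, og_set G A <->
    exists2 g, C2_set n g & A = B *m g *m B^T + (1%:M - B *m B^T)) ->
  property_B G n.
Proof.
move=> n0 BB GE m s gs; pose N : 'M[R]_d := 1%:M - B *m B^T.
have BTN : B^T *m N = 0 by rewrite mulmxBr mulmx1 mulmxA BB mul1mx subrr.
have NB : N *m B = 0 by rewrite mulmxBl mul1mx -mulmxA BB mulmx1 subrr.
have NN : N *m N = N by rewrite {1}/N mulmxBl mul1mx -mulmxA BTN mulmx0 subr0.
have GB A (v : 'cV[R]_d) : og_set G A -> exists2 g, C2_set n g & B^T *m (A *m v) = g *m (B^T *m v).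
  move=> /GE[g gn ->]; exists g => //.
  by rewrite -/N mulmxDl mulmxDr !mulmxA BTN mul0mx addr0 BB mul1mx.
have GN A (v : 'cV[R]_d) : og_set G A -> N *m (A *m v) = N *m v.
  move=> /GE[g gn ->].
  by rewrite -/N mulmxDl mulmxDr !mulmxA NB !mul0mx add0r NN.
pose pi v := cplx (B^T *m v).
have [qr qrE] : exists q, forall v, peval (orbit_map s v) q = normsq (pi v).
  apply: invariant_factor gs _ _.
    exact: polyfunD (polyfunM (polyfun_mx _ 0) (polyfun_mx _ 0))
      (polyfunM (polyfun_mx _ 1) (polyfun_mx _ 1)).
  by move=> A v /(GB _ v)[g gn E]; rewrite /pi E (normsq_isometry _ n0 gn).
have fG A v : og_set G A -> pi (A *m v) ^+ n = pi v ^+ n.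
  move=> /(GB _ v)[g /(rot2_root n0)[z zn gz] E].
  by rewrite /pi E gz exprMn zn mul1r.
have [pr pim] := polyfun_cplxX B^T n.
have [qf1 qf1E] : exists q, forall v, peval (orbit_map s v) q = re (pi v ^+ n).
  by apply: invariant_factor gs pr _ => A v GA; rewrite fG.
have [qf2 qf2E] : exists q, forall v, peval (orbit_map s v) q = im (pi v ^+ n).
  by apply: invariant_factor gs pim _ => A v GA; rewrite fG.
have /choice[qN qNE] : forall i, exists q, forall v, peval (orbit_map s v) q = (N *m v) i 0.
  by move=> i; apply: invariant_factor gs (polyfun_mx N i) _ => A v GA; rewrite GN.
(* The whole orbit space serves as the neighbourhood of 0. *)
exists (range (orbit_map s)); split=> //.
  by rewrite /within /=; exact: nearW.
move=> I c oI _ Cc cU t0 It0.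
pose r t := peval (c t) qr.
pose f t : C := Complex (peval (c t) qf1) (peval (c t) qf2).
pose h i t := peval (c t) (qN i).
have cE t : I t -> exists2 v, orbit_map s v = c t &
    [/\ r t = normsq (pi v), f t = pi v ^+ n & forall i, h i t = (N *m v) i 0].
  move=> /cU[v _ cv]; exists v => //; split.
  - by rewrite /r -cv qrE.
  - by rewrite /f -cv qf1E qf2E; case: (pi v ^+ n).
  - by move=> i; rewrite /h -cv qNE.
have [J [w [M [oJ Jt0 JI wP]]]] : exists J w (M : R), [/\ open J, J t0, J `<=` I &
    forall t, J t -> [/\ cdiff w t, w t ^+ n = f t & normsq (cder w t) <= M]].
  apply: (@root_curve n I r f t0) => //.
  - exact: Ck_peval.
  - exact: Ck_peval.
  - exact: Ck_peval.
  - by move=> t /cE[v _ [-> _ _]]; exact: normsq_ge0.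
  - by move=> t /cE[v _ [-> -> _]]; rewrite normsqX.
have Ch i : Ck 1 I (h i) by apply: (Ck_leq n0); exact: Ck_peval.
have /choice[H HP] : forall i, exists H : R, 0 <= H /\ \forall t \near t0, `|der (h i) t| <= H.
  move=> i; have [H H0 HP] := continuous_near_bounded ((Ch i).2 t0 It0).
  by exists H.
have : \forall t \near t0, forall i, `|der (h i) t| <= H i.
  have hi i : \forall t \near t0, `|der (h i) t| <= H i by have [] := HP i.
  exact: (@filter_forall R 'I_d (fun i t => `|der (h i) t| <= H i) (nbhs t0) _ hi).
move=> /nearP[e e0 eP].
pose x t : 'cV[R]_2 := \col_(j < 2) if j == 0 then re (w t) else im (w t).
have cx t : cplx (x t) = w t by rewrite /cplx !mxE /=; case: (w t).
pose cbar t : 'cV[R]_d := B *m x t + \col_i h i t.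
pose J' := J `&` ball t0 e.
have J'I t : J' t -> I t by move=> [/JI].
have cbarE i t : cbar t i 0 = B i 0 * re (w t) + B i 1 * im (w t) + h i t.
  by rewrite /cbar mxE mx_col2 cx mxE.
pose D i t := B i 0 * der (fun t => re (w t)) t + B i 1 * der (fun t => im (w t)) t + der (h i) t.
have dcoord t i : J' t -> is_derive t 1 (fun t => cbar t i 0) (D i t).
  move=> J't; have [[/derP dwr /derP dwi] _ _] := wP t J't.1.
  have /derP dh := (Ch i).1 t (J'I t J't).
  have -> : (fun t => cbar t i 0) = (B i 0 *: (fun t => re (w t))) +
      (B i 1 *: (fun t => im (w t))) + h i.
    by apply/funext => u; rewrite cbarE.
  exact: is_deriveD (is_deriveD (is_deriveZ _ dwr) (is_deriveZ _ dwi)) dh.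
have dcbar t : J' t -> derivable cbar t 1.
  move=> J't; apply/derivable_mxP => i j; rewrite ord1.
  by have [] := dcoord t i J't.
exists J', cbar; split.
- by apply: openI => //; exact: ball_open.
- by split=> //; exact: ballxx.
- by move=> t /J'I.
split=> //.
- move=> t J't; have [v cv [rv fv hv]] := cE t (J'I t J't).
  have [_ wf _] := wP t J't.1.
  (* c t is the orbit of v; w t has the same power as the plane component of v, so
     that cbar t lies in the orbit of v. *)
  have [g gn xg] : exists2 g, C2_set n g & x t = g *m (B^T *m v).
    by apply: (root_rot2 n0); rewrite cx wf fv.
  pose A := B *m g *m B^T + N.
  have GA : og_set G A by apply/GE; exists g.
  have -> : cbar t = A *m v.
    rewrite /cbar xg /A mulmxDl !mulmxA; congr (_ + _).
    by apply/matrixP => i j; rewrite ord1 mxE hv.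
  rewrite -cv; apply/matrixP => i j; rewrite !mxE.
  exact: hg_inv gs i A v GA.
- move=> K _ KJ.
  pose b := \sum_i (`|B i 0| * (M + 1) + `|B i 1| * (M + 1) + H i).
  have M0 : 0 <= M.
    by have [_ _] := wP t0 Jt0; apply: le_trans; exact: normsq_ge0.
  have t0n i : 0 <= `|B i 0| * (M + 1) + `|B i 1| * (M + 1) + H i.
    by rewrite !addr_ge0 ?mulr_ge0 ?addr_ge0//; have [] := HP i.
  have bP t : K t -> `|derive1 cbar t| <= b.
    move=> Kt; have J't := KJ t Kt; have [_ _ wM] := wP t J't.1.
    rewrite derive1E derive_mx; last exact: dcbar.
    rewrite [leLHS]/Num.Def.normr/= mx_normrE; apply: bigmax_le.
      by apply: sumr_ge0 => i _; exact: t0n.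
    move=> [i j] _ /=; rewrite mxE ord1 (_ : 'D_1 _ t = D i t); last first.
      by have [] := dcoord t i J't.
    rewrite /b (bigD1 i)//=; apply: ler_wpDr; first by apply: sumr_ge0 => k _; exact: t0n.
    have le1 (y z : R) : y ^+ 2 + z ^+ 2 <= M -> `|y| <= M + 1.
      move=> yz; have y2 : `|y| ^+ 2 <= M.
        by rewrite real_normK ?num_real//; apply: le_trans yz; rewrite lerDl sqr_ge0.
      by have := sqr_ge0 (`|y| - 1); have := normr_ge0 y; nra.
    rewrite /D; apply: le_trans (ler_normD _ _) _; apply: lerD.
      apply: le_trans (ler_normD _ _) _; rewrite !normrM; apply: lerD; apply: ler_wpM2l => //.
        exact: le1 wM.
      by apply: (le1 _ (re (cder w t))); rewrite addrC.
    by apply: eP; case: J't => _; rewrite /ball/= distrC.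
  exists b; split; first exact: num_real.
  by move=> b' bb' t Kt; apply: le_trans (bP t Kt) _; exact: ltW.
Qed.

End PropertyB.

Theorem mainTheorem10 (R : realType) (n : nat) (n_ge1 : (1 <= n)%N) :
  property_B (C2 R n) n /\
  (forall (P : {vspace 'cV[R]_3}) (dimP : \dim P = 2%N),
     property_B (C3 n dimP) n).
Proof.
split=> [|P dimP].
  apply: (@extended_rotation_property_B R n 2 1%:M) => //.
    by rewrite trmx1 mulmx1.
  move=> A; rewrite trmx1 mulmx1 subrr; split=> [An|[g gn ->]].
    by exists A => //; rewrite mul1mx mulmx1 addr0.
  by rewrite mul1mx mulmx1 addr0.
have [B BP] := isometry_exists dimP.
apply: (@extended_rotation_property_B R n 3 B) => //; first by case: BP.
by move=> A; exact: C3_setE.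
Qed.
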